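(* Let $\nabla$ be a torsion-free connection on a smooth manifold $M$. The vertical lift of symmetric multivector fields $(\,\cdot\,)^v:\mathfrak{X}^\bullet_{\mathrm{sym}}(M)\to\mathcal{P}ol(T^*M)$ is an algebra isomorphism between the commutative algebras $(\mathfrak{X}^\bullet_{\mathrm{sym}}(M),[\,\cdot\,,\,\cdot\,]_s)$ and $(\mathcal{P}ol(T^*M),\{\,\cdot\,,\,\cdot\,\}_\nabla)$.
   Context: $\mathfrak{X}^r_{\mathrm{sym}}(M)=\Gamma(\mathrm{Sym}^rTM)$, $\mathfrak{X}^\bullet_{\mathrm{sym}}(M)=\bigoplus_{r\ge0}\mathfrak{X}^r_{\mathrm{sym}}(M)$, with symmetric product $\odot$ normalized so that $X\odot Y=X\otimes Y+Y\otimes X$ for vector fields (in general $\mathcal{X}\odot\mathcal{Y}=\frac{(p+q)!}{p!q!}\mathrm{sym}(\mathcal{X}\otimes\mathcal{Y})$). For vector fields, $[X,Y]_s:=\nabla_XY+\nabla_YX$; the symmetric Schouten bracket is the unique $\mathbb{R}$-bilinear commutative map $[\cdot,\cdot]_s$ on $\mathfrak{X}^\bullet_{\mathrm{sym}}(M)$ extending it, with $[X,f]_s=Xf$, and such that for $\mathcal{X}\in\mathfrak{X}^r_{\mathrm{sym}}(M)$ the map $[\mathcal{X},\cdot]_s$ is a degree-$(r-1)$ derivation of $(\mathfrak{X}^\bullet_{\mathrm{sym}}(M),\odot)$ (in particular $[f,h]_s=0$ for functions). Let $\mathrm{pr}:T^*M\to M$ be the projection. A function $F\in C^\infty(T^*M)$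 with $F(\lambda\zeta)=\lambda^rF(\zeta)$ for all $\lambda\in\mathbb{R}$, $\zeta\in T^*M$ is a degree-$r$ polynomial in momenta; $\mathcal{P}ol(T^*M)\subseteq C^\infty(T^*M)$ is the direct sum over $r\ge0$ of the spaces of such functions. The vertical lift is the linear map given by $\mathcal{X}^v(\zeta):=\frac{1}{r!}\mathcal{X}(\zeta,\dots,\zeta)$ for $\mathcal{X}\in\mathfrak{X}^r_{\mathrm{sym}}(M)$, $r>0$, and $f^v:=\mathrm{pr}^*f$ for $r=0$. The Patterson-Walker metric $g_\nabla$ is the split-signature metric on $T^*M$ such that, with $X^h$ the $\nabla$-horizontal lift of $X\in\mathfrak{X}(M)$ to $T^*M$ and $\alpha^v$ the vertical lift of $\alpha\in\Omega^1(M)$ to a vector field on $T^*M$, $g_\nabla(X^h+\alpha^v,Y^h+\beta^v)=\mathrm{pr}^*(\alpha(Y)+\beta(X))$. In natural coordinates $(x^i,p_j)$, $g_\nabla=\mathrm{d}p_j\odot\mathrm{d}x^j-p_k\Gamma^k_{ij}\,\mathrm{d}x^i\odot\mathrm{d}x^j$, with $\Gamma^k_{ij}$ the Christoffel symbols of $\nabla$. The bracket $\{F,G\}_\nabla:=g_\nabla^{-1}(\mathrm{d}F,\mathrm{d}G)$ on $C^\infty(T^*M)$ is, in natural coordinates, $$\{F,G\}_\nabla=\frac{\partial F}{\partial x^i}\frac{\partial G}{\partial p_i}+\frac{\partial F}{\partial p_i}\frac{\partial G}{\partial x^i}+2p_k\Gamma^k_{ij}\frac{\partial F}{\partial p_i}\frac{\partial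 G}{\partial p_j}.$$ ''Algebra isomorphism'' means linear bijection intertwining the brackets (which are commutative, not assumed associative). *)

(* Defs.v *)
From HB Require Import structures.
From mathcomp Require Import all_boot all_order all_algebra all_fingroup.
From mathcomp Require Import all_classical all_reals all_analysis.
Set Implicit Arguments.
Unset Strict Implicit.
Unset Printing Implicit Defensive.
Import Order.TTheory GRing.Theory Num.Theory numFieldNormedType.Exports.
Local Open Scope classical_set_scope.
Local Open Scope ring_scope.

Lemma near_eq_differentiable (R : realType) (V W : normedModType R)
    (f g : V -> W) (x : V) :
  (\near x, f x = g x) -> differentiable f x -> differentiable g x.
Proof.
have key (u v : V -> W) (d : V -> W) : (\near x, u x = v x) ->
    u = cst (u x) + d \o center x +o_x (center x) ->
    v = cst (v x) + d \o center x +o_x (center x).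
  move=> uv /eqaddoP lu; apply/eqaddoP => e e0.
  have ux := nbhs_singleton uv.
  have := lu _ e0; apply: filterS2 uv => y /= uvy.
  by rewrite !fctE /= uvy ux.
have keyx (u v : V -> W) (d : V -> W) : (\near x, u x = v x) ->
    (forall y, u y = u x + d (y - x) +o_(y \near x) (y - x)) ->
    (forall y, v y = v x + d (y - x) +o_(y \near x) (y - x)).
  move=> uv hu y.
  have /(key _ _ _ uv) hv : u = cst (u x) + d \o center x +o_x (center x).
    by apply/funext => z; exact: hu.
  by rewrite [in LHS]hv.
move=> fg.
have gf : \near x, g x = f x by apply: filterS fg => y ->.
have dE : 'd f x = 'd g x.
  rewrite /diff; congr (get _); apply/funext => d; apply/propext.
  by rewrite !lim_id //; split=> -[cd h]; split => //; exact: keyx h.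
move=> [[cd h]]; constructor; rewrite -dE; split=> //.
by move: h; rewrite !lim_id //; exact: key.
Qed.

Section Smooth.
Variables (R : realType) (n : nat).
Implicit Types (U : set 'rV[R]_n) (f g : 'rV[R]_n -> R).

Definition partial (i : 'I_n) f (x : 'rV[R]_n) : R := 'D_(delta_mx 0 i) f x.

Definition grad f (x : 'rV[R]_n) : 'rV[R]_n := \row_i partial i f x.

Fixpoint Ck (k : nat) U f : Prop :=
  if k is k'.+1 then
    (forall x, U x -> differentiable f x) /\ (forall i, Ck k' U (partial i f))
  else forall x, U x -> {for x, continuous f}.

Definition smooth_on U f : Prop := forall k, Ck k U f.

Lemma open_near U (P : 'rV[R]_n -> Prop) x :
  open U -> U x -> (forall y, U y -> P y) -> \forall y \near x, P y.
Proof.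
by move=> oU Ux h; apply: filterS h _; apply: open_nbhs_nbhs; split.
Qed.

Lemma Ck_eq k U f g :
  open U -> (forall x, U x -> f x = g x) -> Ck k U f -> Ck k U g.
Proof.
move=> oU; elim: k f g => [|k IH] f g fg /=.
  move=> cf x Ux; have cfx : f y @[y --> x] --> f x := cf x Ux.
  suff : g y @[y --> x] --> g x by [].
  rewrite -(fg _ Ux); apply: cvg_trans cfx.
  apply: (@near_eq_cvg _ _ (nbhs x) _ f g).
  exact: (open_near (P := fun y => f y = g y) oU Ux fg).
move=> [df pf]; split => [x Ux|i].
  apply: near_eq_differentiable (df _ Ux).
  exact: (open_near (P := fun y => f y = g y) oU Ux).
apply: IH (pf i) => x Ux; apply: near_eq_derive.
exact: (open_near (P := fun y => f y = g y) oU Ux).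
Qed.

Lemma CkS k U f : Ck k.+1 U f -> Ck k U f.
Proof.
elim: k f => [|k IH] f [df pf]; first by move=> x /df/differentiable_continuous.
by split=> // i; exact: IH.
Qed.

Lemma Ck_cst k U (c : R) : open U -> Ck k U (cst c).
Proof.
move=> oU; elim: k c => [|k IH] c /=; first by move=> x _; exact: cst_continuous.
split=> // i; apply: (Ck_eq oU _ (IH 0)) => x _.
by rewrite /partial derive_cst.
Qed.

Lemma CkD k U f g : open U -> Ck k U f -> Ck k U g -> Ck k U (f + g).
Proof.
move=> oU; elim: k f g => [|k IH] f g.
  by move=> cf cg x Ux; apply: continuousD; [exact: cf|exact: cg].
move=> [df pf] [dg pg]; split=> [x Ux|i].
  by apply: differentiableD; [exact: df|exact: dg].
apply: (Ck_eq oU _ (IH _ _ (pf i) (pg i))) => x Ux.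
rewrite /partial deriveD //; apply: diff_derivable.
  exact: df.
exact: dg.
Qed.

Lemma CkM k U f g : open U -> Ck k U f -> Ck k U g -> Ck k U (f * g).
Proof.
move=> oU; elim: k f g => [|k IH] f g.
  by move=> cf cg x Ux; apply: continuousM; [exact: cf|exact: cg].
move=> cf cg; have [df pf] := cf; have [dg pg] := cg; split=> [x Ux|i].
  by apply: differentiableM; [exact: df|exact: dg].
have h : Ck k U (f * partial i g + g * partial i f).
  by apply: (CkD oU); apply: IH; [exact: CkS cf|exact: pg|exact: CkS cg|exact: pf].
apply: (Ck_eq oU _ h) => x Ux.
rewrite /partial deriveM //; apply: diff_derivable.
  exact: df.
exact: dg.
Qed.

Lemma smooth_cst U (c : R) : open U -> smooth_on U (fun=> c).
Proof. by move=> oU k; exact: (@Ck_cst k U c oU). Qed.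

Lemma smoothD U f g :
  open U -> smooth_on U f -> smooth_on U g -> smooth_on U (fun x => f x + g x).
Proof. by move=> oU sf sg k; exact: (CkD oU (sf k) (sg k)). Qed.

Lemma smoothM U f g :
  open U -> smooth_on U f -> smooth_on U g -> smooth_on U (fun x => f x * g x).
Proof. by move=> oU sf sg k; exact: (CkM oU (sf k) (sg k)). Qed.

Lemma smooth_sum U (I : Type) (r : seq I) (F : I -> 'rV[R]_n -> R) :
  open U -> (forall i, smooth_on U (F i)) ->
  smooth_on U (fun x => \sum_(i <- r) F i x).
Proof.
move=> oU sF; elim: r => [|i r IH].
  rewrite (_ : (fun x => _) = fun=> 0); first exact: smooth_cst.
  by apply/funext => x; rewrite big_nil.
rewrite (_ : (fun x => _) = fun x => F i x + \sum_(j <- r) F j x).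
  exact: smoothD.
by apply/funext => x; rewrite big_cons.
Qed.

End Smooth.

(* A second countable Hausdorff space with a smooth atlas, not necessarily
   maximal.  The coordinate map and its inverse are total functions whose
   values outside the chart domain, respectively outside its image, are
   irrelevant. *)
Record smoothManifold (R : realType) (n : nat) := SmoothManifold {
  points :> topologicalType;
  points_hausdorff : hausdorff_space points;
  points_countable : @second_countable points;
  atlas : Type;
  cdom : atlas -> set points;
  chart : atlas -> points -> 'rV[R]_n;
  param : atlas -> 'rV[R]_n -> points;
  atlas_cover : forall p, exists a, cdom a p;
  cdom_open : forall a, open (cdom a);
  cimg_open : forall a, open (chart a @` cdom a);
  chartK : forall a p, cdom a p -> param a (chart a p) = p;
  chart_continuous : forall a p, cdom a p -> {for p, continuous (chart a)};
  param_continuous : forall a x,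
    (chart a @` cdom a) x -> {for x, continuous (param a)};
  transition_smooth : forall a b i,
    smooth_on (chart a @` (cdom a `&` cdom b))
              (fun x => chart b (param a x) 0 i)
}.

Section Manifold.
Variables (R : realType) (n : nat) (M : smoothManifold R n).
Implicit Types (p : M) (a b : atlas M).

Definition cimg a : set 'rV[R]_n := chart a @` cdom a.

Definition smooth_fun (f : M -> R) : Prop :=
  forall a, smooth_on (cimg a) (f \o param a).

(* A covector at p is given by its components in all the charts around p,
   related by the transformation law xi^a_i = xi^b_k dy^k/dx^i, where x and y
   are the coordinates of a and b.  Recall that [jacobian] acts on row vectors
   by multiplication on the right. *)
Definition transformation_law p (xi : atlas M -> 'rV[R]_n) : Prop :=
  (forall a, ~ cdom a p -> xi a = 0) /\
  (forall a b, cdom a p -> cdom b p ->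
     xi a = xi b *m (jacobian (chart b \o param a) (chart a p))^T).

Definition cotangent p : {pred atlas M -> 'rV[R]_n} :=
  fun xi => `[< transformation_law p xi >].

Lemma cotangent_submod p : submod_closed (cotangent p).
Proof.
split; first by apply/asboolP; split=> // a b _ _; rewrite mul0mx.
move=> c u v /asboolP[u0 uJ] /asboolP[v0 vJ]; apply/asboolP; split=> [a pa|a b pa pb].
  by rewrite !fctE u0 // v0 // scaler0 addr0.
by rewrite !fctE mulmxDl -scalemxAl -uJ // -vJ.
Qed.

HB.instance Definition _ p :=
  GRing.isSubmodClosed.Build R (atlas M -> 'rV[R]_n) (cotangent p)
    (cotangent_submod p).

Record covec p := Covec {
  comp :> atlas M -> 'rV[R]_n;
  comp_cotangent : comp \in cotangent p }.

HB.instance Definition _ p := [isSub for @comp p].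
HB.instance Definition _ p := [Choice of covec p by <:].
HB.instance Definition _ p := [SubChoice_isSubLmodule of covec p by <:].

Definition dcomp p (f : M -> R) (a : atlas M) : 'rV[R]_n :=
  if `[< cdom a p >] then grad (f \o param a) (chart a p) else 0.

(* The differential of f at p; see [dcovE]. *)
Definition dcov p (f : M -> R) : covec p := insubd 0 (dcomp p f).

Lemma cimg_chart a p : cdom a p -> cimg a (chart a p).
Proof. by move=> pa; exists p. Qed.

Lemma differentiable_row (F : 'rV[R]_n -> 'rV[R]_n) x :
  (forall i, differentiable (fun y => F y 0 i) x) -> differentiable F x.
Proof.
move=> dF; have -> : F = \sum_i (fun y => F y 0 i *: delta_mx 0 i).
  by apply/funext => y; rewrite fct_sumE [LHS]row_sum_delta.
by apply: differentiable_sum => i; apply: differentiableZl.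
Qed.

Lemma transition_open a b : open (chart a @` (cdom a `&` cdom b)).
Proof.
have -> : chart a @` (cdom a `&` cdom b) = cimg a `&` (param a @^-1` cdom b).
  apply/seteqP; split=> [x [p [pa pb] <-]|x [[p pa <-]] /=].
    by split; [exists p|rewrite /= chartK].
  by rewrite chartK // => pb; exists p.
rewrite openE => x [xa xb]; apply: filterI.
  exact: (cimg_open xa).
exact: (param_continuous xa (open_nbhs_nbhs (conj (cdom_open b) xb))).
Qed.

Lemma transition_differentiable a b p : cdom a p -> cdom b p ->
  differentiable (chart b \o param a) (chart a p).
Proof.
move=> pa pb; apply: differentiable_row => i.
by have [+ _] := transition_smooth a b i 1%N; apply; exists p.
Qed.

Lemma grad_comp (f : 'rV[R]_n -> R) (F : 'rV[R]_n -> 'rV[R]_n) x :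
  differentiable F x -> differentiable f (F x) ->
  grad (f \o F) x = grad f (F x) *m (jacobian F x)^T.
Proof.
move=> dF df; have dfF := differentiable_comp dF df.
have dcE := diff_comp dF df.
apply/rowP => i; rewrite !mxE /partial (deriveE _ dfF) dcE /=.
rewrite -(deriveE _ dF) (deriveEjacobian _ dF) -rowE (row_sum_delta (row _ _)).
rewrite linear_sum /=; apply: eq_bigr => k _.
by rewrite linearZ /= -(deriveE _ df) !mxE mulrC.
Qed.

Lemma dcovE p f :
  (forall a, cdom a p -> differentiable (f \o param a) (chart a p)) ->
  dcov p f = dcomp p f :> (atlas M -> 'rV[R]_n).
Proof.
move=> df; rewrite /dcov /insubd insubT //.
apply/asboolP; split=> [a|a b] pa; first by rewrite /dcomp asboolF.
move=> pb; rewrite /dcomp !asboolT //.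
have pba : (chart b \o param a) (chart a p) = chart b p by rewrite /= chartK.
rewrite -[in RHS]pba -grad_comp; last 2 first.
- exact: transition_differentiable.
- by rewrite pba; exact: df.
apply/rowP => i; rewrite !mxE; apply: near_eq_derive.
have xO : (chart a @` (cdom a `&` cdom b)) (chart a p) by exists p.
have e y : (chart a @` (cdom a `&` cdom b)) y ->
    (f \o param a) y = ((f \o param b) \o (chart b \o param a)) y.
  by move=> [q [qa qb] <-] /=; rewrite chartK // chartK.
exact: (open_near (@transition_open a b) xO e).
Qed.

Lemma dcov_smooth p f : smooth_fun f ->
  dcov p f = dcomp p f :> (atlas M -> 'rV[R]_n).
Proof.
move=> sf; apply: dcovE => a pa; have [+ _] := sf a 1%N.
by apply; exact: cimg_chart.
Qed.

(* dx^k at p, where x is the coordinate system of a. *)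
Definition dcoord a p (k : 'I_n) : covec p := dcov p (fun q => chart a q 0 k).

Definition covec_of a p (w : 'rV[R]_n) : covec p :=
  \sum_k w 0 k *: dcoord a p k.

Lemma partial_coord i k (x : 'rV[R]_n) :
  partial i (fun y : 'rV[R]_n => y 0 k) x = (k == i)%:R.
Proof.
have @f : {linear 'rV[R]_n -> R}.
  by exists (fun y : 'rV[R]_n => y 0 k); do 2![eexists]; do ?[constructor];
     rewrite ?mxE// => ? *; rewrite ?mxE//; move=> ?; rewrite !mxE.
have cf : continuous f := @coord_continuous R _ _ 0 k.
rewrite /partial (_ : (fun _ => _) = f) // deriveE; last first.
  exact/linear_differentiable.
by rewrite diff_lin // /= mxE eqxx.
Qed.

Lemma dcoordE a p k : cdom a p -> dcoord a p k a = delta_mx 0 k.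
Proof.
move=> pa; rewrite /dcoord dcovE => [|b pb].
  rewrite /dcomp asboolT //; apply/rowP => i; rewrite !mxE /=.
  rewrite -[RHS](_ : partial i (fun x : 'rV[R]_n => x 0 k) (chart a p) = _).
    apply: near_eq_derive.
    have e y : cimg a y ->
        ((fun q => chart a q 0 k) \o param a) y = (fun x : 'rV[R]_n => x 0 k) y.
      by move=> [q qa <-] /=; rewrite chartK.
    exact: (open_near (@cimg_open _ _ _ a) (cimg_chart pa) e).
  by rewrite partial_coord eq_sym.
by have [+ _] := transition_smooth b a k 1%N; apply; exists p.
Qed.

Lemma covec_ofE a p w : cdom a p -> covec_of a p w a = w.
Proof.
move=> pa; rewrite [RHS]row_sum_delta /covec_of.
rewrite (big_morph (fun xi : covec p => xi a) (id1 := 0) (op1 := +%R)) //.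
by apply: eq_bigr => k _; rewrite -(dcoordE k pa).
Qed.

End Manifold.

Section Symmetrisation.
Variables (R : realType) (V : Type).
Implicit Types (T : seq V -> R) (s : seq V).

(* sym T (v_1, ..., v_r) = 1/r! sum_sigma T (v_sigma(1), ..., v_sigma(r)). *)
Definition symz T s : R :=
  (size s)`!%:R^-1 *
  \sum_(sigma : 'S_(size s)) T [tuple tnth (in_tuple s) (sigma i) | i < size s].

Lemma symzE m T (t : m.-tuple V) :
  symz T t = m`!%:R^-1 * \sum_(sigma : 'S_m) T [tuple tnth t (sigma i) | i < m].
Proof.
case: t => s /= sm; move: (sm); case: _ / (eqP sm) => sm'.
rewrite /symz; congr (_ * _); apply: eq_bigr => sigma _ /=; congr T.
apply: eq_map => i; pose x0 := tnth (in_tuple s) i.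
by rewrite [LHS](tnth_nth x0) [RHS](tnth_nth x0).
Qed.

End Symmetrisation.

Lemma symz_perm (R : realType) (V : eqType) (T : seq V -> R) (s t : seq V) :
  perm_eq s t -> symz T s = symz T t.
Proof.
move=> st; have szt : size s == size t by rewrite (perm_size st).
have [tau e] := tuple_permP (t := in_tuple t) st.
rewrite e symzE [RHS](symzE T (in_tuple t)); congr (_ * _).
rewrite [RHS](reindex_inj (mulIg tau)) /=.
apply: eq_bigr => sigma _ /=; congr T; apply: eq_map => i.
by rewrite tnth_mktuple permM.
Qed.

Section Multilinear.
Variables (R : realType) (V : lmodType R).
Implicit Types (T X Y : seq V -> R) (s u v w : seq V).

Definition multilinear T : Prop := forall i c u v w,
  size u = size w -> size v = size w -> (i < size w)%N ->
  w`_i = c *: u`_i + v`_i ->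
  (forall j, j != i -> w`_j = u`_j /\ w`_j = v`_j) ->
  T w = c * T u + T v.

Lemma multilinear_sym T :
  (forall s t, perm_eq s t -> T s = T t) ->
  (forall s c x y, T (c *: x + y :: s) = c * T (x :: s) + T (y :: s)) ->
  multilinear T.
Proof.
move=> symT linT i c u v w su sv iw wi wj.
have decomp s : (i < size s)%N -> T s = T (s`_i :: take i s ++ drop i.+1 s).
  move=> i_s; apply: symT; rewrite -[X in perm_eq X _](cat_take_drop i) (drop_nth 0) //.
  by rewrite perm_catC /= perm_cons perm_catC.
rewrite decomp // wi linT.
have same s : size s = size w -> (forall j, j != i -> w`_j = s`_j) ->
    take i w ++ drop i.+1 w = take i s ++ drop i.+1 s.
  move=> ss e; congr (_ ++ _); apply: (@eq_from_nth _ 0).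
  - by rewrite !size_take ss.
  - move=> j; rewrite size_take iw => ji.
    by rewrite !nth_take // e // neq_ltn ji.
  - by rewrite !size_drop ss.
  - move=> j _; rewrite !nth_drop e // neq_ltn orbC addSn ltnS leq_addr.
    by [].
rewrite {1}(same u) // => [|j /wj[]//]; rewrite (same v) // => [|j /wj[]//].
by rewrite -!decomp ?su ?sv.
Qed.

Lemma multilinear_tens k X Y : multilinear X -> multilinear Y ->
  multilinear (fun s => X (take k s) * Y (drop k s)).
Proof.
move=> mX mY i c u v w su sv iw wi wj.
have [ik|ki] := ltnP i k.
  have dropE s : size s = size w -> (forall j, j != i -> w`_j = s`_j) ->
      drop k s = drop k w.
    move=> ss e; apply: (@eq_from_nth _ 0); first by rewrite !size_drop ss.
    by move=> j _; rewrite !nth_drop e // neq_ltn orbC (leq_trans ik) ?leq_addr.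
  rewrite (dropE u) // => [|j /wj[]//]; rewrite (dropE v) // => [|j /wj[]//].
  rewrite mulrA -mulrDl; congr (_ * _); apply: (mX i).
  - by rewrite !size_take su.
  - by rewrite !size_take sv.
  - by rewrite size_take; case: ifP.
  - by rewrite !nth_take.
  - move=> j ji; have [jk|kj] := ltnP j k; first by rewrite !nth_take //; exact: wj.
    by rewrite !nth_default // size_take_min geq_min kj.
have takeE s : size s = size w -> (forall j, j != i -> w`_j = s`_j) ->
    take k s = take k w.
  move=> ss e; apply: (@eq_from_nth _ 0); first by rewrite !size_take ss.
  move=> j; rewrite size_take_min leq_min => /andP[jk _].
  by rewrite !nth_take // e // neq_ltn (leq_trans jk).
rewrite (takeE u) // => [|j /wj[]//]; rewrite (takeE v) // => [|j /wj[]//].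
rewrite mulrCA -mulrDr; congr (_ * _); apply: (mY (i - k)%N).
- by rewrite !size_drop su.
- by rewrite !size_drop sv.
- by rewrite size_drop ltn_sub2r // (leq_ltn_trans ki).
- by rewrite !nth_drop subnKC.
- move=> j ji; rewrite !nth_drop; apply: wj.
  by apply: contraNneq ji => <-; rewrite addKn.
Qed.

Lemma symz_linear T : multilinear T -> forall s c x y,
  symz T (c *: x + y :: s) = c * symz T (x :: s) + symz T (y :: s).
Proof.
move=> mT s c x y; pose tup z := [tuple of z :: in_tuple s].
rewrite (symzE T (tup _)) (symzE T (tup x)) (symzE T (tup y)).
rewrite mulrCA -mulrDr; congr (_ * _); rewrite mulr_sumr -big_split /=.
apply: eq_bigr => sigma _.
have nthE z (j : 'I_(size s).+1) :
    [seq tnth (tup z) (sigma k) | k <- enum 'I_(size s).+1]`_j = (z :: s)`_(sigma j).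
  by rewrite (nth_map j) ?size_enum_ord // nth_ord_enum (tnth_nth 0).
pose i := (sigma^-1)%g ord0.
have szE z : size [seq tnth (tup z) (sigma k) | k <- enum 'I_(size s).+1] = (size s).+1.
  by rewrite size_map size_enum_ord.
apply: (mT i); rewrite ?szE //.
  by rewrite !nthE /i permKV.
move=> j ji; have [jm|mj] := ltnP j (size s).+1; last by rewrite !nth_default ?szE.
rewrite (_ : j = Ordinal jm) // !nthE.
have : sigma (Ordinal jm) != ord0.
  by apply: contraNneq ji => sj; rewrite /i -sj permK.
by case: (sigma _) => -[].
Qed.

End Multilinear.

Section Fields.
Variables (R : realType) (n : nat) (M : smoothManifold R n).
Implicit Types (p : M) (a : atlas M).

(* An element of the direct sum of the Gamma(Sym^r TM) is encoded as a single
   function of a point and a finite sequence of covectors at that point: its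
   restriction to the sequences of length r is the component of degree r. *)
Definition covecs := {p : M & seq (covec p)}.

Record is_symfield (X : covecs -> R) : Prop := IsSymfield {
  symfield_perm : forall p (s t : seq (covec p)),
    perm_eq s t -> X (existT _ p s) = X (existT _ p t);
  symfield_linear : forall p (s : seq (covec p)) c u v,
    X (existT _ p (c *: u + v :: s)) =
    c * X (existT _ p (u :: s)) + X (existT _ p (v :: s));
  symfield_smooth : forall a (ws : seq 'rV[R]_n),
    smooth_on (cimg a)
      (fun x => X (existT _ (param a x) [seq covec_of a (param a x) w | w <- ws]));
  symfield_finite : exists N, forall p (s : seq (covec p)),
    (N <= size s)%N -> X (existT _ p s) = 0 }.

Definition symfield_pred : {pred covecs -> R} := fun X => `[< is_symfield X >].

Lemma symfield_submod : submod_closed symfield_pred.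
Proof.
split.
  apply/asboolP; split=> //.
  - by move=> *; rewrite mulr0 addr0.
  - by move=> a ws; apply: smooth_cst; exact: cimg_open.
  - by exists 0%N.
move=> k X Y /asboolP[Xp Xl Xs [N XN]] /asboolP[Yp Yl Ys [N' YN]].
apply/asboolP; split.
- by move=> p s t st; rewrite !fctE (Xp _ _ _ st) (Yp _ _ _ st).
- move=> p s c u v; rewrite !fctE Xl Yl !scalerDr mulrDr -!addrA.
  by rewrite scalerAr; congr (_ + _); rewrite addrCA.
- move=> a ws; have oU := @cimg_open _ _ _ a.
  apply: (smoothD oU); last exact: Ys.
  apply: (smoothM oU); last exact: Xs.
  exact: smooth_cst.
- exists (N + N')%N => p s Ns; rewrite !fctE XN ?YN ?scaler0 ?addr0 //.
    exact: leq_trans (leq_addl _ _) Ns.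
  exact: leq_trans (leq_addr _ _) Ns.
Qed.

HB.instance Definition _ :=
  GRing.isSubmodClosed.Build R (covecs -> R) symfield_pred symfield_submod.

Record symfield := Symfield {
  symfield_val :> covecs -> R;
  symfieldP : symfield_val \in symfield_pred }.

HB.instance Definition _ := [isSub for symfield_val].
HB.instance Definition _ := [Choice of symfield by <:].
HB.instance Definition _ := [SubChoice_isSubLmodule of symfield by <:].

Implicit Types (X Y Z : symfield) (f : M -> R).

Definition ev X p (s : seq (covec p)) : R := X (existT _ p s).

(* The subspace of the fields of degree r.  Those of degree 0 are the smooth
   functions on M and those of degree 1 are the vector fields. *)
Definition homog (r : nat) : set symfield :=
  [set X | forall p (s : seq (covec p)), size s != r -> ev X s = 0].

Definition fn X p : R := ev X ([::] : seq (covec p)).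

(* The symmetric product.  Its component of degree (p, q) is
   (p + q)! / (p! q!) times the symmetrisation of the tensor product. *)
Definition sprod_val X Y : covecs -> R := fun z =>
  let: existT p s := z in
  \sum_(k < (size s).+1) 'C(size s, k)%:R *
    symz (fun t : seq (covec p) => ev X (take k t) * ev Y (drop k t)) s.

Lemma sprod_subproof X Y : sprod_val X Y \in symfield_pred.
Proof.
have /asboolP[Xp Xl Xs [N XN]] := symfieldP X.
have /asboolP[Yp Yl Ys [N' YN]] := symfieldP Y.
apply/asboolP; split => /=.
- move=> p s t st; rewrite -(perm_size st); apply: eq_bigr => k _.
  by rewrite (symz_perm _ st).
- move=> p s c u v; rewrite mulr_sumr -big_split /=; apply: eq_bigr => k _.
  rewrite symz_linear; first by rewrite mulrDr mulrCA.
  apply: multilinear_tens; apply: multilinear_sym.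
  + exact: Xp.
  + exact: Xl.
  + exact: Yp.
  + exact: Yl.
- move=> a ws; have oU := @cimg_open _ _ _ a.
  pose W x (w : 'rV[R]_n) := covec_of a (param a x) w.
  pose perm_ws (sigma : 'S_(size ws)) :=
    [tuple tnth (in_tuple ws) (sigma i) | i < size ws].
  rewrite (_ : (fun x => _) = (fun x => \sum_(k < (size ws).+1)
    ('C(size ws, k)%:R * (size ws)`!%:R^-1) * \sum_(sigma : 'S_(size ws))
      (ev X (map (W x) (take k (perm_ws sigma))) *
       ev Y (map (W x) (drop k (perm_ws sigma)))))).
    apply: (smooth_sum _ oU) => k; apply: (smoothM oU); first exact: smooth_cst.
    by apply: (smooth_sum _ oU) => sigma; apply: (smoothM oU);
      [exact: Xs|exact: Ys].
  apply/funext => x; rewrite size_map; apply: eq_bigr => k _.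
  rewrite (symzE _ (map_tuple (W x) (in_tuple ws))) mulrA; congr (_ * _).
  apply: eq_bigr => sigma _.
  have -> : [tuple tnth (map_tuple (W x) (in_tuple ws)) (sigma i) | i < size ws] =
      map (W x) (perm_ws sigma) :> seq _.
    by rewrite /= -map_comp; apply: eq_map => i; rewrite /= tnth_map.
  by rewrite map_take map_drop.
- exists (N + N')%N => p s Ns; rewrite big1 // => k _.
  rewrite /symz big1 ?mulr0 // => sigma _.
  have [Nk|kN] := leqP N k.
    rewrite /ev XN ?mul0r // size_takel //.
    by rewrite size_map size_enum_ord -ltnS ltn_ord.
  rewrite /ev YN ?mulr0 // size_drop size_map size_enum_ord.
  rewrite leq_subRL; last by rewrite -ltnS ltn_ord.
  by apply: leq_trans Ns; rewrite leq_add2r ltnW.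
Qed.

Definition sprod X Y : symfield := Symfield (sprod_subproof X Y).

End Fields.

Section Connection.
Variables (R : realType) (n : nat) (M : smoothManifold R n).
Implicit Types (X Y Z h : symfield M) (f : M -> R) (p : M) (a : atlas M).

(* The derivative Xf of a function along a vector field. *)
Definition lie X f p : R := ev X [:: dcov p f].

(* The operator is a total function on all symmetric fields; only its values
   on pairs of vector fields are constrained, or used. *)
Record connection := Connection {
  nabla :> symfield M -> symfield M -> symfield M;
  nabla_deg : forall X Y, homog 1 X -> homog 1 Y -> homog 1 (nabla X Y);
  nablaDl : forall X Y Z, homog 1 X -> homog 1 Y -> homog 1 Z ->
    nabla (X + Y) Z = nabla X Z + nabla Y Z;
  nablaMl : forall h X Y, homog 0 h -> homog 1 X -> homog 1 Y ->
    nabla (sprod h X) Y = sprod h (nabla X Y);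
  nablaDr : forall X Y Z, homog 1 X -> homog 1 Y -> homog 1 Z ->
    nabla X (Y + Z) = nabla X Y + nabla X Z;
  nabla_leibniz : forall h X Y, homog 0 h -> homog 1 X -> homog 1 Y ->
    forall p (xi : covec p), ev (nabla X (sprod h Y)) [:: xi] =
      lie X (fn h) p * ev Y [:: xi] + fn h p * ev (nabla X Y) [:: xi] }.

Variable D : connection.

Definition torsion_free : Prop := forall X Y f,
  homog 1 X -> homog 1 Y -> smooth_fun f ->
  forall p, lie (D X Y - D Y X) f p = lie X (lie Y f) p - lie Y (lie X f) p.

Record is_schouten (B : symfield M -> symfield M -> symfield M) : Prop :=
  IsSchouten {
  schouten_linear : forall (c : R) X Y Z,
    B (c *: X + Y) Z = c *: B X Z + B Y Z;
  schouten_comm : forall X Y, B X Y = B Y X;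
  schouten_vector_fields : forall X Y, homog 1 X -> homog 1 Y ->
    B X Y = D X Y + D Y X;
  schouten_function : forall X h, homog 1 X -> homog 0 h ->
    forall p, fn (B X h) p = lie X (fn h) p;
  schouten_deg : forall r k X Y, homog r X -> homog k Y ->
    forall p (s : seq (covec p)), (size s).+1 != (r + k)%N -> ev (B X Y) s = 0;
  schouten_derivation : forall r X Y Z, homog r X ->
    B X (sprod Y Z) = sprod (B X Y) Z + sprod Y (B X Z) }.

(* The symmetric Schouten bracket is the unique such operation, whence the
   definite description. *)
Definition schouten : symfield M -> symfield M -> symfield M :=
  xget (fun _ _ => 0) [set B | is_schouten B].

End Connection.

Section Cotangent.
Variables (R : realType) (n : nat) (M : smoothManifold R n).
Implicit Types (X Y : symfield M) (p : M) (a : atlas M).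

Definition cotbundle := {p : M & covec p}.
Implicit Types (zeta : cotbundle) (F G : cotbundle -> R).

(* Natural coordinates (x^i, p_j) on the cotangent bundle. *)
Definition nat_chart a zeta : 'rV[R]_(n + n) :=
  row_mx (chart a (projT1 zeta)) (projT2 zeta a).

Definition nat_param a (z : 'rV[R]_(n + n)) : cotbundle :=
  existT _ (param a (lsubmx z)) (covec_of a (param a (lsubmx z)) (rsubmx z)).

Definition smooth_cot F : Prop :=
  forall a, smooth_on [set z | cimg a (lsubmx z)] (F \o nat_param a).

Definition homogeneous_polynomial (r : nat) F : Prop :=
  smooth_cot F /\ forall (c : R) p (xi : covec p),
    F (existT _ p (c *: xi)) = c ^+ r * F (existT _ p xi).

Definition Pol : set (cotbundle -> R) :=
  [set F | exists (N : nat) (G : nat -> cotbundle -> R),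
     (forall r, homogeneous_polynomial r (G r)) /\ F = \sum_(r < N) G r].

(* The sum over r is finitely supported; its r-th term is the vertical lift of
   the component of degree r. *)
Definition vlift X : cotbundle -> R := fun zeta =>
  \sum_(r \in [set: nat]) r`!%:R^-1 * ev X (nseq r (projT2 zeta)).

Variable D : connection M.

Definition coordinate_field_near a p (i : 'I_n) X : Prop :=
  homog 1 X /\ \forall q \near p, forall xi : covec q, ev X [:: xi] = xi a 0 i.

(* Gamma^k_ij at p, i.e. dx^k (nabla_{d/dx^i} d/dx^j), computed with any global
   extensions of the germs at p of the coordinate vector fields. *)
Definition christoffel a p (k i j : 'I_n) : R :=
  xget 0 [set c | forall X Y, coordinate_field_near a p i X ->
    coordinate_field_near a p j Y -> ev (D X Y) [:: dcoord a p k] = c].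

Definition momentum_christoffel a zeta : 'M[R]_n :=
  \matrix_(i, j) \sum_k projT2 zeta a 0 k * christoffel a (projT1 zeta) k i j.

(* The matrix of g_nabla at zeta in the natural coordinates of the chart a:
   dp_j (.) dx^j - p_k Gamma^k_ij dx^i (.) dx^j. *)
Definition pw_metric a zeta : 'M[R]_(n + n) :=
  let A := momentum_christoffel a zeta in
  block_mx (- (A + A^T)) 1%:M 1%:M 0.

(* Horizontal and vertical lifts to the tangent space at zeta, in natural
   coordinates; [pw_metric_lifts] is the coordinate-free characterisation of
   g_nabla. *)
Definition hlift a zeta (v : 'rV[R]_n) : 'rV[R]_(n + n) :=
  row_mx v (v *m momentum_christoffel a zeta).

Definition vertical (w : 'rV[R]_n) : 'rV[R]_(n + n) := row_mx 0 w.

Lemma pw_metric_lifts a zeta (X Y al be : 'rV[R]_n) :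
  (hlift a zeta X + vertical al) *m pw_metric a zeta *m
    (hlift a zeta Y + vertical be)^T = al *m Y^T + be *m X^T.
Proof.
rewrite /hlift /vertical /pw_metric; set A := momentum_christoffel a zeta.
rewrite !add_row_mx !addr0 mul_row_block !mulmx1 mulmx0 addr0 tr_row_mx.
rewrite mul_row_col !(linearD, mulmxDl, mulmxDr, mulmxN, mulNmx) /= !trmx_mul.
have tr1 (M1 : 'M[R]_1) : M1^T = M1 by apply/matrixP => i j; rewrite mxE !ord1.
rewrite -(tr1 (be *m X^T)) trmx_mul trmxK !mulmxA.
by rewrite addrACA subrK -addrA addKr.
Qed.

Lemma invmx_pw_metric a zeta : let A := momentum_christoffel a zeta in
  invmx (pw_metric a zeta) = block_mx 0 1%:M 1%:M (A + A^T).
Proof.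
move=> A; set B := block_mx 0 _ _ _.
have mB : pw_metric a zeta *m B = 1%:M.
  rewrite mulmx_block !mulmx0 !mul0mx !mulmx1 !mul1mx add0r !addr0 addNr.
  by rewrite -scalar_mx_block.
have [uM _] := mulmx1_unit mB.
by rewrite -[LHS]mulmx1 -mB mulKmx.
Qed.

Definition pw_bracket_in a F G zeta : R :=
  let d H := grad (H \o nat_param a) (nat_chart a zeta) in
  (d F *m invmx (pw_metric a zeta) *m (d G)^T) 0 0.

(* g_nabla^-1 (dF, dG), whose expression is the same in all the natural
   coordinate systems. *)
Definition pw_bracket F G : cotbundle -> R := fun zeta =>
  xget 0 [set c | forall a, cdom a (projT1 zeta) ->
                    pw_bracket_in a F G zeta = c].

End Cotangent.

Definition algebra_isomorphism (R : realType) (V W : lmodType R)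
    (brV : V -> V -> V) (A : set W) (brW : W -> W -> W) (f : V -> W) : Prop :=
  [/\ linear f, set_bij [set: V] A f &
      forall x y, f (brV x y) = brW (f x) (f y)].

(* Main.v *)
(* The vertical lift turns the symmetric product into the pointwise product, so
   that both brackets, evaluated at a fixed covector, become symmetric
   biderivations with values in R.  A derivation at a covector which kills the
   functions and the vector fields is zero: if phi is a cutoff function of a
   chart and E_i = phi d/dx^i, Euler's identity writes phi^2 X, for X of degree
   r + 1, as 1/(r + 1) sum_i E_i (.) (phi X(dx^i, ...)), and one concludes by
   induction on r.  Hence two such biderivations with the same values on
   functions and vector fields coincide; on those generators, the bracket of
   g_nabla computed in any natural chart has the values prescribed for the
   Schouten bracket.  This shows at once that the bracket of g_nabla does not
   depend on the chart, that it corresponds to any Schouten bracket, and that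
   transporting it through the vertical lift yields one.

   For the bijectivity, a field is recovered from its lift by polarisation.
   Conversely a smooth function F which is homogeneous of degree r on the fibres
   is polynomial on them, by Euler's identity again, and it is the lift of
   (xi_1, ..., xi_r) |-> Delta_(xi_1) ... Delta_(xi_r) F (0), where Delta_xi is
   the finite difference operator. *)
Require Import Defs.
From mathcomp Require Import all_boot all_order all_algebra all_fingroup.
From mathcomp Require Import all_classical all_reals all_analysis.
From mathcomp Require Import ring.
Set Implicit Arguments.
Unset Strict Implicit.
Unset Printing Implicit Defensive.
Import Order.TTheory GRing.Theory Num.Theory numFieldNormedType.Exports.
Local Open Scope classical_set_scope.
Local Open Scope ring_scope.

(** * Smooth functions on open sets of R^n *)

Section Calculus.
Context {R : realType}.

Lemma Ck_subset n k (U V : set 'rV[R]_n) f : V `<=` U -> Ck k U f -> Ck k V f.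
Proof.
move=> VU; elim: k f => [|k IH] f /=; first by move=> cf x /VU /cf.
by move=> [df pf]; split=> [x /VU /df|i]; [|apply: IH].
Qed.

(** [Ck] imposes conditions at the individual points of the set, each about the function on the
    whole space near that point. It can therefore be checked on any sets through the points. *)
Lemma Ck_local n k (U : set 'rV[R]_n) f :
  (forall x, U x -> exists V, V x /\ Ck k V f) -> Ck k U f.
Proof.
elim: k f => [|k IH] f /= h; first by move=> x /h[V [Vx]]; apply.
split=> [x /h[V [Vx [df _]]]|i]; first exact: df.
by apply: IH => x /h[V [Vx [_ pf]]]; exists V.
Qed.

Lemma smooth_local n (U : set 'rV[R]_n) f :
  (forall x, U x -> exists V, V x /\ smooth_on V f) -> smooth_on U f.
Proof.
by move=> h k; apply: Ck_local => x /h[V [Vx sf]]; exists V.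
Qed.

Lemma smooth_subset n (U V : set 'rV[R]_n) f :
  V `<=` U -> smooth_on U f -> smooth_on V f.
Proof. by move=> VU sf k; apply: Ck_subset (sf k). Qed.

Lemma smooth_eq n (U : set 'rV[R]_n) f g : open U ->
  (forall x, U x -> f x = g x) -> smooth_on U f -> smooth_on U g.
Proof. by move=> oU fg sf k; exact: Ck_eq (sf k). Qed.

Lemma smooth_partial n (U : set 'rV[R]_n) f i :
  smooth_on U f -> smooth_on U (partial i f).
Proof. by move=> sf k; have [_] := sf k.+1; apply. Qed.

Lemma smooth_differentiable n (U : set 'rV[R]_n) f x :
  smooth_on U f -> U x -> differentiable f x.
Proof. by move=> sf; have [+ _] := sf 1%N; apply. Qed.

Lemma linear_coord n (k : 'I_n) :
  {f : {linear 'rV[R]_n -> R} | forall x, f x = x 0 k}.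
Proof.
have @f : {linear 'rV[R]_n -> R}.
  by exists (fun y : 'rV[R]_n => y 0 k); do 2![eexists]; do ?[constructor];
     rewrite ?mxE// => ? *; rewrite ?mxE//; move=> ?; rewrite !mxE.
by exists f.
Qed.

Lemma diff_coord n (k : 'I_n) (x v : 'rV[R]_n) :
  differentiable (fun y : 'rV[R]_n => y 0 k) x /\
  'd (fun y : 'rV[R]_n => y 0 k) x v = v 0 k.
Proof.
have [f fE] := linear_coord k.
rewrite -(_ : f = (fun y : 'rV[R]_n => y 0 k) :> (_ -> _)); last exact/funext.
have cf : continuous f by move=> y; have := @coord_continuous R 1 n 0 k y;
  rewrite (_ : f = (fun y : 'rV[R]_n => y 0 k) :> (_ -> _)) //; exact/funext.
split; first exact: linear_differentiable.
by rewrite diff_lin.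
Qed.

Lemma smooth_coord n (U : set 'rV[R]_n) (k : 'I_n) :
  open U -> smooth_on U (fun x : 'rV[R]_n => x 0 k).
Proof.
move=> oU [|m] /=; first by move=> x _; apply: coord_continuous.
split=> [x _|i]; first by have [] := diff_coord k x 0.
apply: (Ck_eq oU _ (@Ck_cst R n m U (k == i)%:R oU)) => x _.
by rewrite partial_coord.
Qed.

Lemma differentiable_coords m n (F : 'rV[R]_m -> 'rV[R]_n) x :
  (forall i, differentiable (fun y => F y 0 i) x) -> differentiable F x.
Proof.
move=> dF; have -> : F = \sum_i (fun y => F y 0 i *: delta_mx 0 i).
  by apply/funext => y; rewrite fct_sumE [LHS]row_sum_delta.
by apply: differentiable_sum => i; apply: differentiableZl.
Qed.

Lemma partial_comp m n (g : 'rV[R]_n -> R) (F : 'rV[R]_m -> 'rV[R]_n) x i :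
  (forall k, differentiable (fun y => F y 0 k) x) -> differentiable g (F x) ->
  partial i (fun y => g (F y)) x =
    \sum_k partial k g (F x) * partial i (fun y => F y 0 k) x.
Proof.
move=> dFk dg; have dF := differentiable_coords dFk.
have dgF : differentiable (g \o F) x := differentiable_comp dF dg.
rewrite /partial (deriveE _ dgF) (diff_comp dF dg) /=.
rewrite (row_sum_delta ('d F x _)) linear_sum; apply: eq_bigr => k _.
rewrite linearZ /= -(deriveE _ dg) mulrC; congr (_ * _).
rewrite (deriveE _ (dFk k)).
have [dk _] := diff_coord k (F x) 0.
rewrite (diff_comp (f := F) (g := fun y : 'rV[R]_n => y 0 k) dF dk) /=.
by have [_ ->] := diff_coord k (F x) ('d F x (delta_mx 0 i)).
Qed.

(** The induction is on the order of differentiability, with [F] fixed and [g] replaced by its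
    partial derivatives, as the chain rule requires. *)
Lemma smooth_comp m n (U : set 'rV[R]_m) (V : set 'rV[R]_n)
    (g : 'rV[R]_n -> R) (F : 'rV[R]_m -> 'rV[R]_n) :
  open U -> (forall x, U x -> V (F x)) -> smooth_on V g ->
  (forall k, smooth_on U (fun x => F x 0 k)) -> smooth_on U (fun x => g (F x)).
Proof.
move=> oU UV sg sF k.
have dFk x : U x -> forall i, differentiable (fun y => F y 0 i) x.
  by move=> Ux i; exact: smooth_differentiable (sF i) Ux.
elim: k g sg => [|k IH] g sg.
  move=> x Ux; apply: differentiable_continuous.
  apply: (differentiable_comp (f := F)).
    exact: differentiable_coords (dFk x Ux).
  exact: smooth_differentiable sg (UV _ Ux).
split=> [x Ux|i].
  apply: (differentiable_comp (f := F)).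
    exact: differentiable_coords (dFk x Ux).
  exact: smooth_differentiable sg (UV _ Ux).
have h : Ck k U (\sum_j (fun x => partial j g (F x)) *
    partial i (fun y => F y 0 j)).
  elim/big_rec: _ => [|j f _ sf]; first exact: Ck_cst.
  apply: (CkD oU) sf; apply: (CkM oU); first exact: IH (smooth_partial j sg).
  exact: (smooth_partial i (sF j)).
apply: (Ck_eq oU _ h) => x Ux; rewrite fct_sumE partial_comp //; first exact: dFk.
exact: smooth_differentiable sg (UV _ Ux).
Qed.

Lemma smoothN n (U : set 'rV[R]_n) f :
  open U -> smooth_on U f -> smooth_on U (fun x => - f x).
Proof.
move=> oU sf; apply: (smooth_eq oU (f := fun x => -1 * f x)).
  by move=> x _; rewrite mulN1r.
by apply: (smoothM oU) => //; exact: smooth_cst.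
Qed.

End Calculus.

(** * Bump functions *)

Section Flat.
Context {R : realType}.

(* The factor t^-m makes the family stable under differentiation. *)
Definition flat (m : nat) (t : R) : R :=
  if 0 < t then t^-1 ^+ m * expR (- t^-1) else 0.

(** The constant comes from the term of degree m + 2 in the exponential series at 1/t. The square on
    the right gives the derivative 0 at the origin. *)
Lemma flat_bound m t : `|flat m t| <= (m.+2)`!%:R * t ^+ 2.
Proof.
rewrite /flat; case: ifPn => t0; last by rewrite normr0 mulr_ge0 // sqr_ge0.
have s0 : 0 <= t^-1 by rewrite invr_ge0 ltW.
rewrite ger0_norm; last by rewrite mulr_ge0 ?exprn_ge0 ?expR_ge0.
rewrite expRN ler_pdivrMr ?expR_gt0 //.
have h : t^-1 ^+ m.+2 <= (m.+2)`!%:R * expR t^-1.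
  have := expR_ge1Dxn m.+1 s0; rewrite -ler_pdivrMl ?ltr0n ?fact_gt0 //.
  by apply: le_trans; rewrite mulrC lerDr.
have -> : t^-1 ^+ m = t ^+ 2 * t^-1 ^+ m.+2.
  by rewrite -(addn2 m) exprD mulrCA -exprMn divff ?gt_eqF // expr1n mulr1.
by rewrite [leRHS]mulrAC [leRHS]mulrC ler_pM2l // exprn_gt0.
Qed.

Lemma is_derive_inv (t : R) : t != 0 -> is_derive t 1 (fun y => y^-1) (- t ^- 2).
Proof.
move=> t0; have h := @deriveV R R id t 1 t0 (@derivable_id _ _ t 1).
apply: DeriveDef; first exact: derivableV.
by rewrite h derive_id [LHS]mulr1.
Qed.

Lemma is_derive_flat m (t : R) :
  is_derive t 1 (flat m) (flat m.+2 t - m%:R * flat m.+1 t).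
Proof.
have [t0|t0|->] := ltgtP t 0.
- rewrite {2 3}/flat ltNge (ltW t0) /= mulr0 subr0.
  apply: (@near_eq_is_derive _ _ _ (cst 0)).
  near=> y; rewrite /flat ltNge ifF //; apply/negbTE; rewrite negbK.
  by near: y; apply: filterS (lt_nbhsl t0) => y; exact: ltW.
- rewrite {2 3}/flat t0.
  have tn0 : t != 0 by rewrite gt_eqF.
  apply: (@near_eq_is_derive R R R (fun y : R => y^-1 ^+ m * expR (- y^-1))).
    near=> y; rewrite /flat ifT //.
    by near: y; exact: lt_nbhsr.
  have di := is_derive_inv tn0.
  have h := is_deriveM (is_deriveX m di)
    (is_derive1_comp (is_derive_expR _) (is_deriveN di)).
  have -> : (fun y : R => y^-1 ^+ m * expR (- y^-1)) =
    (fun y : R => y^-1) ^+ m * (expR \o - (fun y : R => y^-1)).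
    by rewrite exprfctE.
  apply: (is_derive_eq h); rewrite !fctE /=.
  rewrite /GRing.scale /= opprK -(addn2 m) -(addn1 m) !exprD expr2 expr1.
  case: m {h} => [|m]; rewrite ?mul0r ?mulr0 /= ?exprS ?expr0; field.
    by [].
  by [].
- rewrite {2 3}/flat ltxx mulr0 subr0.
  (* At the origin the difference quotient is [flat m h] divided by [h], which [flat_bound] makes
     O(|h|). *)
  suff h : h^-1 *: (flat m (h *: 1 + 0) - flat m 0) @[h --> (0:R)^'] --> (0 : R).
    apply: DeriveDef; last exact: (cvg_lim (@Rhausdorff R) h).
    by apply/cvg_ex; exists 0.
  have -> : (fun h : R => h^-1 *: (flat m (h *: 1 + 0) - flat m 0)) =
            (fun h => h^-1 * flat m h).
    by apply/funext => h; rewrite {2}/flat ltxx subr0 addr0 /GRing.scale /= mulr1.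
  apply/norm_cvg0P.
  apply: (@squeeze_cvgr _ _ _ _ (cst 0) (fun h => (m.+2)`!%:R * `|h|)).
  + near=> h; rewrite normr_ge0 /= normrM normfV.
    have h0 : 0 < `|h| by rewrite normr_gt0; near: h; exact: nbhs_dnbhs_neq.
    rewrite mulrC ler_pdivrMr // -mulrA -expr2 real_normK ?num_real //.
    exact: flat_bound.
  + exact: cvg_cst.
  + rewrite -[X in _ --> X](mulr0 ((m.+2)`!%:R : R)).
    apply: cvgM; first exact: cvg_cst.
    rewrite -[X in _ --> X](@normr0 _ R); apply: cvg_norm.
    exact: cvg_trans (@nbhs_dnbhs _ (0:R)) _.
Unshelve. all: by end_near. Qed.

End Flat.

Section Bump.
Context {R : realType}.

(** The induction on [k] runs over all [m] at once, since differentiating [flat m] produces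
    [flat m.+1] and [flat m.+2]. *)
Lemma smooth_flat n (U : set 'rV[R]_n) m u :
  open U -> smooth_on U u -> smooth_on U (fun x => flat m (u x)).
Proof.
move=> oU su k.
have df j t : differentiable (@flat R j) t.
  by apply/derivable1_diffP; have [] := is_derive_flat j t.
elim: k m => [|k IH] m.
  move=> x Ux; apply: differentiable_continuous.
  apply: (differentiable_comp (f := u)) => //.
  exact: smooth_differentiable su Ux.
split=> [x Ux|i].
  apply: (differentiable_comp (f := u)) => //.
  exact: smooth_differentiable su Ux.
have h : Ck k U (partial i u * ((fun x => flat m.+2 (u x)) +
    cst (- m%:R) * (fun x => flat m.+1 (u x)))).
  apply: (CkM oU); first exact: (smooth_partial i su).
  apply: (CkD oU); first exact: IH.
  by apply: (CkM oU); [exact: Ck_cst|exact: IH].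
apply: (Ck_eq oU _ h) => x Ux; rewrite !fctE.
have du := smooth_differentiable su Ux.
have dc : differentiable (flat m \o u) x by exact: (differentiable_comp (f := u)).
rewrite /partial [RHS](deriveE _ dc) (diff_comp du (df _ _)) /=.
rewrite -(deriveE _ du) -[X in 'd _ _ X]mulr1 [RHS]linearZ /= -(deriveE _ (df _ _)).
by have /@derive_val -> := is_derive_flat m (u x); rewrite mulNr.
Qed.

(* [flat 0] vanishes for t <= 0 and is at least [flat 0 1] for t >= 1, so that
   no division by a function is needed to get a plateau. *)
Definition cutoff (t : R) : R :=
  (flat 0 (flat 0 1))^-1 * flat 0 (flat 0 1 - flat 0 t).

Lemma flat_gt0 t : 0 < t -> 0 < @flat R 0 t.
Proof. by move=> t0; rewrite /flat t0 expr0 mul1r expR_gt0. Qed.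

Lemma cutoff1 t : t <= 0 -> cutoff t = 1.
Proof.
move=> t0; have ft : flat 0 t = 0 by rewrite /flat ltNge t0.
rewrite /cutoff ft subr0 mulVf //.
by rewrite gt_eqF // flat_gt0 // flat_gt0.
Qed.

Lemma cutoff0 t : 1 <= t -> cutoff t = 0.
Proof.
move=> t1; have t0 : 0 < t by apply: lt_le_trans t1.
suff ft : flat 0 1 <= flat 0 t.
  by rewrite /cutoff [X in _ * X]/flat ltNge subr_le0 ft mulr0.
rewrite /flat t0 ltr01 !expr0 !mul1r ler_expR lerN2 invr1.
by rewrite invf_le1.
Qed.

(** The cutoff is applied to the squared Euclidean distance [q], a polynomial, instead of the
    maximum norm of ['rV]. The argument 2 q / r - 1 is nonpositive for q <= r / 2 and at least 1 for
    q >= r. *)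
Lemma bump_rV n (U : set 'rV[R]_n) x0 : open U -> U x0 ->
  exists (f : 'rV[R]_n -> R) (K : set 'rV[R]_n),
    [/\ smooth_on [set: 'rV[R]_n] f, \near x0, f x0 = 1,
      (forall x, ~ K x -> f x = 0), compact K & K `<=` U].
Proof.
move=> oU Ux0.
have oT : open [set: 'rV[R]_n] := openT.
have [e e0 eU] : exists2 e : R, 0 < e & forall x, ball x0 e x -> U x.
  have /nbhs_ballP[e e0 h] := open_nbhs_nbhs (conj oU Ux0).
  by exists e.
pose q (x : 'rV[R]_n) := \sum_i (x 0 i - x0 0 i) * (x 0 i - x0 0 i).
have sq : smooth_on [set: 'rV[R]_n] q.
  apply: (smooth_sum _ oT) => i.
  by apply: (smoothM oT); apply: (smoothD oT);
    [exact: smooth_coord|exact: smooth_cst|exact: smooth_coord|exact: smooth_cst].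
have cq : continuous q.
  by move=> x; apply: differentiable_continuous; exact: smooth_differentiable sq _.
pose r := (e / 2) ^+ 2.
have r0 : 0 < r by rewrite exprn_gt0 // divr_gt0.
have qi (x : 'rV[R]_n) i : (x 0 i - x0 0 i) ^+ 2 <= q x.
  rewrite /q (bigD1 i) //= -expr2 lerDl sumr_ge0 // => j _.
  by rewrite -expr2 sqr_ge0.
pose K := [set x : 'rV[R]_n | q x <= r].
have Kball x : K x -> ball x0 e x.
  move=> Kx; split => // i j; rewrite /ball /= ord1 distrC.
  have e2 : e / 2 < e by rewrite ltr_pdivrMr // ltr_pMr // ltr1n.
  apply: le_lt_trans e2; rewrite -(@ler_pXn2r _ 2) ?nnegrE //; last first.
    by rewrite divr_ge0 // ltW.
  by rewrite real_normK ?num_real //; exact: le_trans (qi x j) Kx.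
exists (fun x => cutoff (2 / r * q x - 1)), K; split.
- apply: (smoothM oT); first exact: smooth_cst.
  apply: smooth_flat => //; apply: (smoothD oT); first exact: smooth_cst.
  apply: smoothN => //; apply: smooth_flat => //.
  apply: (smoothD oT); last exact: smooth_cst.
  by apply: (smoothM oT) => //; exact: smooth_cst.
- near=> x; apply: cutoff1; rewrite subr_le0 mulrAC ler_pdivrMr // mul1r.
  have : q x < r / 2.
    near: x.
    have q0 : q x0 = 0 by rewrite /q big1 // => i _; rewrite subrr mul0r.
    have : q x0 < r / 2 by rewrite q0 divr_gt0.
    by move=> h; exact: (cq x0 _ (lt_nbhsl h)).
  by rewrite ltr_pdivlMr // mulrC => /ltW.
- move=> x /negP; rewrite -ltNge => rx; apply: cutoff0.
  rewrite lerBrDr mulrAC ler_pdivlMr // (_ : 1 + 1 = 2) //.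
  by rewrite ler_pM2l // ltW.
- apply: bounded_closed_compact.
    exists (`|x0| + e); split; first exact: num_real.
    move=> y hy x /Kball; rewrite -ball_normE /= => xe.
    apply: le_trans (ltW hy).
    rewrite -[x](subrK x0) (le_trans (ler_normD _ _)) // addrC lerD2l.
    by rewrite distrC ltW.
  apply: (@closed_comp _ _ q [set t | t <= r]) => [x _|]; first exact: cq.
  exact: closed_le.
- by move=> x /Kball /eU.
Unshelve. all: by end_near. Qed.

End Bump.

(** * Covectors and natural coordinates *)

Section Covectors.
Context {R : realType} {n : nat} {M : smoothManifold R n}.
Implicit Types (p q : M) (a b : atlas M).

Lemma covec_compZ p c (u : covec p) a : (c *: u) a = c *: u a.
Proof. by []. Qed.

(** The transformation law fixes the components in every chart around [p] from those in one; in the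
    other charts they are 0 by convention. *)
Lemma covec_ext a p (xi eta : covec p) : cdom a p -> xi a = eta a -> xi = eta.
Proof.
move=> pa e; apply: val_inj; apply/funext => b /=.
have /asboolP[xi0 xiJ] := comp_cotangent xi.
have /asboolP[eta0 etaJ] := comp_cotangent eta.
have [pb|pb] := pselect (cdom b p); last by rewrite xi0 // eta0.
by rewrite (xiJ b a pb pa) (etaJ b a pb pa) e.
Qed.

Lemma covec_of_comp a p (xi : covec p) : cdom a p -> covec_of a p (xi a) = xi.
Proof. by move=> pa; apply: (covec_ext pa); rewrite covec_ofE. Qed.

Lemma covec_ofP a p c (v w : 'rV[R]_n) :
  covec_of a p (c *: v + w) = c *: covec_of a p v + covec_of a p w.
Proof.
rewrite /covec_of scaler_sumr -big_split /=; apply: eq_bigr => k _.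
by rewrite !mxE scalerDl scalerA.
Qed.

Lemma covec_of_delta a p k : covec_of a p (delta_mx 0 k) = dcoord a p k.
Proof.
rewrite /covec_of (bigD1 k) //= mxE !eqxx scale1r big1 ?addr0 // => j jk.
by rewrite mxE eqxx (negbTE jk) scale0r.
Qed.

Lemma dcoord_comp a b q i : cdom a q -> cdom b q ->
  dcoord a q i b = grad (fun x => chart a (param b x) 0 i) (chart b q).
Proof.
move=> qa qb; rewrite /dcoord dcovE => [|c qc].
  by rewrite /Defs.dcomp asboolT.
by apply: smooth_differentiable (transition_smooth c a i) _; exists q.
Qed.

Lemma smooth_dcoord a b i k :
  smooth_on (chart b @` (cdom b `&` cdom a))
    (fun x => dcoord a (param b x) i b 0 k).
Proof.
apply: (smooth_eq (@transition_open _ _ _ _ _)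
  _ (smooth_partial k (transition_smooth b a i))) => _ [q [qb qa] <-].
by rewrite chartK // dcoord_comp // mxE.
Qed.

(** The components are combinations of partial derivatives of the transition from [a] to [b],
    evaluated at the image of the point under the opposite transition. *)
Lemma smooth_covec_of a b w i :
  smooth_on (chart b @` (cdom b `&` cdom a))
    (fun x => covec_of b (param b x) w a 0 i).
Proof.
have oU := @transition_open _ _ M b a.
apply: (smooth_eq oU (f := fun x => \sum_k w 0 k *
    partial i (fun y => chart b (param a y) 0 k) (chart a (param b x)))).
  move=> _ [q [qb qa] <-]; rewrite chartK // /covec_of.
  rewrite (big_morph (fun xi : covec q => xi a) (id1 := 0) (op1 := +%R)) //.
  rewrite summxE; apply: eq_bigr => k _.
  by rewrite covec_compZ mxE dcoord_comp // [in RHS]mxE.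
apply: (smooth_sum _ oU) => k; apply: (smoothM oU); first exact: smooth_cst.
apply: (smooth_comp oU (V := chart a @` (cdom a `&` cdom b))
  (F := fun x => chart a (param b x))).
- by move=> _ [q [qb qa] <-]; rewrite chartK //; exists q.
- exact: (smooth_partial i (transition_smooth a b k)).
- by move=> j; exact: transition_smooth.
Qed.

Lemma nat_paramK a (z : 'rV[R]_(n + n)) : cimg a (lsubmx z) ->
  nat_chart a (nat_param (M := M) a z) = z.
Proof.
move=> [q qa e]; rewrite /nat_chart /nat_param /=.
rewrite covec_ofE; last by rewrite -e chartK.
by rewrite -e chartK // e hsubmxK.
Qed.

Lemma nat_chartK a (zeta : cotbundle M) : cdom a (projT1 zeta) ->
  nat_param a (nat_chart a zeta) = zeta.
Proof.
case: zeta => p xi /= pa; rewrite /nat_chart /nat_param /= row_mxKl row_mxKr.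
(* The fibre depends on the base point, so [param a (chart a p)] is generalised to a variable point
   before the equation is eliminated. *)
have h q : q = p -> existT (fun p => covec p) q (covec_of a q (xi a)) =
    existT _ p xi by move=> ->; rewrite covec_of_comp.
by apply: h; rewrite chartK.
Qed.

End Covectors.

(** * Cutoff functions and globally defined fields *)

Arguments ev : simpl never.

Section Fields.
Context {R : realType} {n : nat} {M : smoothManifold R n}.
Implicit Types (p q : M) (a b : atlas M) (X Y Z h : symfield M).

Lemma symfield_ext X Y :
  (forall p (s : seq (covec p)), ev X s = ev Y s) -> X = Y.
Proof. by move=> e; apply: val_inj; apply/funext => -[p s]; exact: e. Qed.

Lemma evP X Y c p (s : seq (covec p)) : ev (c *: X + Y) s = c * ev X s + ev Y s.
Proof. by []. Qed.

Lemma evD X Y p (s : seq (covec p)) : ev (X + Y) s = ev X s + ev Y s.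
Proof. by []. Qed.

Lemma ev0 p (s : seq (covec p)) : ev (0 : symfield M) s = 0.
Proof. by []. Qed.

Lemma ev_sum I (r : seq I) (P : pred I) (F : I -> symfield M) p
    (s : seq (covec p)) :
  ev (\sum_(i <- r | P i) F i) s = \sum_(i <- r | P i) ev (F i) s.
Proof. by rewrite (big_morph (fun X => ev X s) (id1 := 0) (op1 := +%R)). Qed.

Lemma symfield_is X : is_symfield X.
Proof. exact/asboolP/symfieldP. Qed.

Lemma ev_perm X p (s t : seq (covec p)) : perm_eq s t -> ev X s = ev X t.
Proof. by have [h _ _ _] := symfield_is X; exact: h. Qed.

Lemma ev_linear X p (s : seq (covec p)) c u v :
  ev X (c *: u + v :: s) = c * ev X (u :: s) + ev X (v :: s).
Proof. by have [_ h _ _] := symfield_is X; exact: h. Qed.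

Lemma ev_linear0 X p (s : seq (covec p)) : ev X (0 :: s) = 0.
Proof. by have := ev_linear X s (-1) 0 0; rewrite scaler0 addr0 mulN1r addNr. Qed.

Lemma ev_linear_sum X p (s : seq (covec p)) I (r : seq I) (F : I -> R)
    (v : I -> covec p) :
  ev X (\sum_(i <- r) F i *: v i :: s) = \sum_(i <- r) F i * ev X (v i :: s).
Proof.
elim: r => [|i r IH]; first by rewrite !big_nil ev_linear0.
by rewrite !big_cons ev_linear IH.
Qed.

Lemma ev_smooth X a (ws : seq 'rV[R]_n) : smooth_on (cimg a)
  (fun x => ev X [seq covec_of a (param a x) w | w <- ws]).
Proof. by have [_ _ h _] := symfield_is X; exact: h. Qed.

Lemma ev_finite X : exists N, forall p (s : seq (covec p)),
  (N <= size s)%N -> ev X s = 0.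
Proof. by have [_ _ _ h] := symfield_is X. Qed.

Lemma ev_coord X a p (xi : covec p) s : cdom a p ->
  ev X (xi :: s) = \sum_k xi a 0 k * ev X (dcoord a p k :: s).
Proof. by move=> pa; rewrite -{1}(covec_of_comp xi pa) ev_linear_sum. Qed.

Lemma symfield_of (X : covecs M -> R) : is_symfield X ->
  exists Y, forall p (s : seq (covec p)), ev Y s = X (existT _ p s).
Proof. by move=> /asboolP h; exists (Symfield h). Qed.

Lemma cimg_param_open b (O : set M) :
  open O -> open (cimg b `&` (param b @^-1` O)).
Proof.
move=> oO; rewrite openE => x [xb xO]; apply: filterI; first exact: (cimg_open xb).
exact: (param_continuous xb (open_nbhs_nbhs (conj oO xO))).
Qed.

Lemma cimgP b x : cimg b x -> cdom b (param b x) /\ chart b (param b x) = x.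
Proof. by move=> [q qb <-]; rewrite chartK. Qed.

(* [K] need not be compact: a set closed in M and contained in the chart domain
   suffices for extensions by zero to be smooth. *)
Definition is_cutoff a (phi : M -> R) := smooth_fun phi /\
  exists K, [/\ closed K, K `<=` cdom a & forall q, ~ K q -> phi q = 0].

(** Extension by zero: a point of the chart [b] lies either in the domain of [a], where [G] is
    smooth, or in the open complement of [K], where [G] vanishes. *)
Lemma smooth_vanishing a b (K : set M) G : closed K -> K `<=` cdom a ->
  (forall x, cimg b x -> ~ K (param b x) -> G x = 0) ->
  smooth_on (chart b @` (cdom b `&` cdom a)) G -> smooth_on (cimg b) G.
Proof.
move=> cK Ka G0 sG; apply: smooth_local => x xb.
have [qb xE] := cimgP xb.
have [qa|qa] := pselect (cdom a (param b x)).
  by exists (chart b @` (cdom b `&` cdom a)); split=> //; exists (param b x).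
have oV := @cimg_param_open b (~` K) (closed_openC cK).
exists (cimg b `&` (param b @^-1` (~` K))); split; first by split=> // /Ka.
apply: (smooth_eq oV _ (smooth_cst 0 oV)) => y [yb yK].
by rewrite G0.
Qed.

Lemma cutoff_smooth a phi b G : is_cutoff a phi ->
  smooth_on (chart b @` (cdom b `&` cdom a)) G ->
  smooth_on (cimg b) (fun x => phi (param b x) * G x).
Proof.
move=> [sphi [K [cK Ka phi0]]] sG.
apply: (smooth_vanishing cK Ka) => [x xb xK|]; first by rewrite phi0 // mul0r.
apply: (smoothM (@transition_open _ _ _ _ _) _ sG).
by apply: smooth_subset (sphi b) => _ [q [qb _] <-]; exists q.
Qed.

Lemma cutoff_exists a p : cdom a p ->
  exists phi, is_cutoff a phi /\ \near p, phi p = 1.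
Proof.
move=> pa.
have [f [K [sf f1 f0 cK Ka]]] := bump_rV (@cimg_open _ _ _ a) (cimg_chart pa).
pose phi q := if `[< cdom a q >] then f (chart a q) else 0.
(* Hausdorffness of [M] enters here: the image of [K] is compact, hence closed in [M] and not only
   in the chart domain. *)
have cL : closed (param a @` K).
  apply: (compact_closed (@points_hausdorff _ _ M)).
  apply: continuous_compact cK; apply: continuous_in_subspaceT => x.
  by rewrite inE => /Ka; exact: param_continuous.
have La : param a @` K `<=` cdom a.
  by move=> _ [x Kx <-]; have [] := cimgP (Ka _ Kx).
have phi0 q : ~ (param a @` K) q -> phi q = 0.
  rewrite /phi => qK; case: asboolP => // qa; apply: f0 => Kq; apply: qK.
  by exists (chart a q) => //; rewrite chartK.
exists phi; split.
  split; last by exists (param a @` K).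
  move=> b; apply: (smooth_vanishing cL La); first by move=> x _ /phi0.
  have oU := @transition_open _ _ M b a.
  apply: (smooth_eq oU (f := fun x => f (chart a (param b x)))).
    by move=> _ [q [qb qa] <-]; rewrite /= chartK // /phi asboolT.
  apply: (smooth_comp oU (V := setT)) => // k; exact: transition_smooth.
have h1 : \near p, f (chart a p) = 1 := chart_continuous pa f1.
have h2 : \near p, cdom a p by apply: open_nbhs_nbhs; split=> //; exact: cdom_open.
by apply: filterS2 h1 h2 => q q1 qa; rewrite /phi asboolT.
Qed.

Lemma fn_smooth h : smooth_fun (fn h).
Proof. by move=> a; exact: (ev_smooth h a [::]). Qed.

Lemma function_field (f : M -> R) : smooth_fun f ->
  exists h, homog 0 h /\ fn h = f.
Proof.
move=> sf; pose X (z : covecs M) := let: existT p s := z in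
  if s is [::] then f p else 0.
have [|h hE] := @symfield_of X; last first.
  exists h; split; last by apply/funext => p; rewrite /fn hE.
  by move=> p [|? ?] //; rewrite hE.
split.
- by move=> p [|? ?] [|? ?] // /perm_size.
- by move=> *; rewrite /= mulr0 addr0.
- move=> a [|w ws]; first exact: sf.
  exact: (smooth_cst 0 (@cimg_open _ _ _ a)).
- by exists 1%N => p [].
Qed.

(** This is phi d/dx^i, made global by the cutoff. *)
Lemma coordinate_field a phi i : is_cutoff a phi ->
  exists E, homog 1 E /\ forall p (xi : covec p), ev E [:: xi] = phi p * xi a 0 i.
Proof.
move=> cphi; pose X (z : covecs M) := let: existT p s := z in
  if s is [:: xi] then phi p * xi a 0 i else 0.
have [|h hE] := @symfield_of X; last first.
  exists h; split; last by move=> p xi; rewrite hE.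
  by move=> p [|? [|? ?]] //; rewrite hE.
split.
- move=> p [|x [|x' s]] [|y [|y' t]] // /[dup] /perm_size // _.
  by move=> /perm_mem /(_ x); rewrite !inE eqxx => /esym /eqP ->.
- move=> p [|? ?] c u v /=; last by rewrite mulr0 addr0.
  by rewrite !mxE mulrDr mulrCA.
- have s0 b := smooth_cst (0 : R) (@cimg_open _ _ M b).
  move=> b [|w [|? ?]] /=; [exact: s0| |exact: s0].
  apply: (cutoff_smooth cphi); exact: smooth_covec_of.
- by exists 2%N => p [|? []].
Qed.

(** Contraction of [X] with phi dx^i. In another chart [b], the cutoff reduces smoothness to the
    overlap, where dx^i is expanded in the coordinate covectors of [b]. *)
Lemma contracted_field a phi i X : is_cutoff a phi ->
  exists Y, forall p (s : seq (covec p)), ev Y s = phi p * ev X (dcoord a p i :: s).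
Proof.
move=> cphi; pose Y (z : covecs M) := let: existT p s := z in
  phi p * ev X (dcoord a p i :: s).
have [|h hE] := @symfield_of Y; last by exists h.
have swap p (x y : covec p) s : ev X (x :: y :: s) = ev X (y :: x :: s).
  by apply: ev_perm; apply/seq.permP => f /=; rewrite addnCA.
split.
- by move=> p s t st /=; congr (_ * _); apply: ev_perm; rewrite perm_cons.
- move=> p s c u v /=.
  by rewrite swap ev_linear ![ev X (_ :: dcoord _ _ _ :: _)]swap mulrDr mulrCA.
- move=> b ws; apply: (cutoff_smooth cphi).
  have oU := @transition_open _ _ M b a.
  apply: (smooth_eq oU (f := fun x => \sum_k dcoord a (param b x) i b 0 k *
    ev X [seq covec_of b (param b x) w | w <- delta_mx 0 k :: ws])).
    move=> _ [q [qb qa] <-]; rewrite [RHS](@ev_coord _ b) ?chartK //.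
    by apply: eq_bigr => k _ /=; rewrite covec_of_delta.
  apply: (smooth_sum _ oU) => k; apply: (smoothM oU); first exact: smooth_dcoord.
  apply: smooth_subset (ev_smooth X b _).
  by move=> _ [q [qb qa] <-]; exists q.
- have [N XN] := ev_finite X.
  by exists N => p s Ns /=; rewrite XN ?mulr0 //= ltnW.
Qed.

Lemma component X r : exists Y, homog r Y /\
  forall p (s : seq (covec p)), ev Y s = if size s == r then ev X s else 0.
Proof.
pose Y (z : covecs M) := let: existT p s := z in
  if size s == r then ev X s else 0.
have [|h hE] := @symfield_of Y; last first.
  by exists h; split=> [p s /negbTE sr|//]; rewrite hE /= sr.
split.
- by move=> p s t st /=; rewrite (perm_size st) (ev_perm X st).
- move=> p s c u v /=; case: ifP => _; first exact: ev_linear.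
  by rewrite mulr0 addr0.
- move=> a ws; rewrite (_ : (fun _ => _) = fun x => if size ws == r then
    ev X [seq covec_of a (param a x) w | w <- ws] else 0).
    case: (size ws == r); first exact: ev_smooth.
    exact: (smooth_cst 0 (@cimg_open _ _ _ a)).
  by apply/funext => x /=; rewrite size_map.
- have [N XN] := ev_finite X.
  by exists N => p s Ns /=; rewrite XN //; case: ifP.
Qed.

Lemma components X : exists N (Y : nat -> symfield M),
  (forall r, homog r (Y r)) /\ X = \sum_(r < N) Y r.
Proof.
have [N XN] := ev_finite X.
have /boolp.choice[Y YP] := component X.
exists N, Y; split=> [r|]; first by have [] := YP r.
apply: symfield_ext => p s; rewrite ev_sum.
have [sN|Ns] := ltnP (size s) N.
  rewrite (bigD1 (Ordinal sN)) //= (YP _).2 eqxx big1 ?addr0 // => r rs.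
  by rewrite (YP _).2 ifF //; apply: contraNF rs => /eqP e; apply/eqP/val_inj.
by rewrite XN // big1 // => r _; rewrite (YP _).2 XN //; case: ifP.
Qed.

End Fields.

(** * The vertical lift *)

Section Lift.
Context {R : realType} {n : nat} {M : smoothManifold R n}.
Implicit Types (p q : M) (a b : atlas M) (X Y Z h : symfield M).

Lemma poly_fun_eq0 (P : {poly R}) : (forall t, P.[t] = 0) -> P = 0.
Proof.
move=> P0; apply/eqP; apply: contraT => Pn0.
(* The points 0, 1, ..., [size P] - 1 are one root too many for a nonzero [P]. *)
have := max_poly_roots (rs := [seq i%:R | i <- iota 0 (size P)]) Pn0.
rewrite size_map size_iota ltnn; apply.
  by apply/allP => x _; rewrite /root P0.
by rewrite map_inj_uniq ?iota_uniq // => i j /eqP; rewrite eqr_nat => /eqP.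
Qed.

Lemma ev_catCA X p (u : covec p) s t : ev X (u :: s ++ t) = ev X (s ++ u :: t).
Proof. by apply: ev_perm; rewrite -[_ :: _]cat1s perm_catCA. Qed.

Lemma ev_linearZ X p c (u : covec p) s : ev X (c *: u :: s) = c * ev X (u :: s).
Proof. by rewrite -[c *: u]addr0 ev_linear ev_linear0 addr0. Qed.

Lemma ev_nseqZ X p c (u : covec p) r s :
  ev X (nseq r (c *: u) ++ s) = c ^+ r * ev X (nseq r u ++ s).
Proof.
elim: r s => [|r IH] s; first by rewrite expr0 mul1r.
by rewrite /= ev_linearZ ev_catCA IH exprS mulrA -ev_catCA.
Qed.

(* The coefficient of t in X(u + t v, ..., u + t v) is r X(v, u, ..., u). *)
Lemma ev_nseq_poly X p (u v : covec p) r s : exists P : {poly R},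
  [/\ forall t, P.[t] = ev X (nseq r (t *: v + u) ++ s),
      P`_0 = ev X (nseq r u ++ s) &
      P`_1 = r%:R * ev X (v :: nseq r.-1 u ++ s)].
Proof.
elim: r s => [|r IH] s.
  exists (ev X s)%:P; split; rewrite ?coefC //=; last by rewrite mul0r.
  by move=> t; rewrite hornerC.
have [P [PE P0 P1]] := IH (u :: s); have [Q [QE Q0 Q1]] := IH (v :: s).
(* Expanding the first slot t v + u gives t times the polynomial with [v] there plus the one with
   [u] there. *)
exists ('X * Q + P); split.
- by move=> t; rewrite !hornerE PE QE /= ev_linear -!ev_catCA.
- by rewrite coefD coefXM /= add0r P0 /= -ev_catCA.
- rewrite coefD coefXM /= Q0 P1 -ev_catCA.
  case: r {IH P P0 P1 PE Q Q0 Q1 QE} => [|r] /=; first by rewrite mul0r addr0 mul1r.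
  rewrite (_ : ev X (v :: nseq r u ++ u :: s) = ev X [:: v, u & nseq r u ++ s]).
    by rewrite -[in RHS]natr1 mulrDl mul1r addrC.
  by apply: ev_perm; rewrite perm_cons perm_sym -(cat1s u) perm_catCA.
Qed.

(** One slot is freed at a time: the polynomial t |-> X(u + t v, ..., u + t v, s') vanishes
    identically, hence so does its linear coefficient, in which one slot holds [v]. The sequence
    [s'] collects the slots already freed. *)
Lemma polarization X p r s' : (forall u : covec p, ev X (nseq r u ++ s') = 0) ->
  forall s, size s = r -> ev X (s ++ s') = 0.
Proof.
elim: r s' => [|r IH] s' X0 s; first by move=> /size0nil ->; exact: (X0 0).
case: s => // v s [sr]; rewrite /= ev_catCA; apply: IH sr => u.
have [P [PE _ P1]] := ev_nseq_poly X u v r.+1 s'.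
have : P = 0 by apply: poly_fun_eq0 => t; rewrite PE X0.
move=> P0; move: P1; rewrite P0 coef0 => /esym/eqP.
by rewrite mulf_eq0 pnatr_eq0 /= ev_catCA => /eqP.
Qed.

Lemma vliftE X (zeta : cotbundle M) N :
  (forall r, (N <= r)%N -> ev X (nseq r (projT2 zeta)) = 0) ->
  vlift X zeta = \sum_(r < N) r`!%:R^-1 * ev X (nseq r (projT2 zeta)).
Proof.
move=> X0; rewrite /vlift (fsbig_ord _ _ (fun r => r`!%:R^-1 * ev X (nseq r _))).
apply/esym/fsbig_widen => // r /= [_ /negP]; rewrite -leqNgt => /X0 ->.
by rewrite mulr0.
Qed.

Lemma vlift_homog r X : homog r X ->
  forall zeta, vlift X zeta = r`!%:R^-1 * ev X (nseq r (projT2 zeta)).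
Proof.
move=> hX zeta; rewrite (vliftE (N := r.+1)) => [|k rk]; last first.
  by apply: hX; rewrite size_nseq neq_ltn rk orbT.
rewrite big_ord_recr /= big1 ?add0r // => k _; rewrite hX ?mulr0 //.
by rewrite size_nseq neq_ltn ltn_ord.
Qed.

Lemma vlift_fn h zeta : homog 0 h -> vlift h zeta = fn h (projT1 zeta).
Proof. by move=> /vlift_homog ->; rewrite fact0 invr1 mul1r. Qed.

Lemma vlift_vf X zeta : homog 1 X -> vlift X zeta = ev X [:: projT2 zeta].
Proof. by move=> /vlift_homog ->; rewrite invr1 mul1r. Qed.

Lemma vlift_linear : linear (@vlift R n M).
Proof.
move=> c X Y; apply/funext => zeta.
have [N1 X0] := ev_finite X; have [N2 Y0] := ev_finite Y.
have X0' r : (N1 + N2 <= r)%N -> ev X (nseq r (projT2 zeta)) = 0.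
  by move=> h; apply: X0; rewrite size_nseq (leq_trans _ h) // leq_addr.
have Y0' r : (N1 + N2 <= r)%N -> ev Y (nseq r (projT2 zeta)) = 0.
  by move=> h; apply: Y0; rewrite size_nseq (leq_trans _ h) // leq_addl.
have XY0 r : (N1 + N2 <= r)%N -> ev (c *: X + Y) (nseq r (projT2 zeta)) = 0.
  by move=> rN; rewrite evP X0' // Y0' // mulr0 addr0.
rewrite -[RHS]/(c * vlift X zeta + vlift Y zeta).
rewrite (vliftE XY0) (vliftE X0') (vliftE Y0').
rewrite mulr_sumr -big_split /=; apply: eq_bigr => r _.
by rewrite evP mulrDr mulrCA.
Qed.

Lemma vliftP c X Y zeta : vlift (c *: X + Y) zeta = c * vlift X zeta + vlift Y zeta.
Proof. by rewrite vlift_linear. Qed.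

Lemma vlift0 zeta : vlift (0 : symfield M) zeta = 0.
Proof. by have := vliftP (-1) 0 0 zeta; rewrite scaler0 addr0 mulN1r addNr. Qed.

Lemma vliftD X Y zeta : vlift (X + Y) zeta = vlift X zeta + vlift Y zeta.
Proof. by rewrite -[X]scale1r vliftP mul1r scale1r. Qed.

Lemma vliftZ c X zeta : vlift (c *: X) zeta = c * vlift X zeta.
Proof. by rewrite -[c *: X]addr0 vliftP vlift0 addr0. Qed.

Lemma vlift_sum I (r : seq I) (P : pred I) (F : I -> symfield M) zeta :
  vlift (\sum_(i <- r | P i) F i) zeta = \sum_(i <- r | P i) vlift (F i) zeta.
Proof.
apply: (big_morph (fun X => vlift X zeta)); last exact: vlift0.
by move=> ? ?; exact: vliftD.
Qed.

(** Along a line in the fibre the lift is a polynomial whose coefficients separate the degrees of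
    [X]. Injectivity and multiplicativity of the lift both rest on this. *)
Lemma vlift_scale X p c (xi : covec p) N :
  (forall q (s : seq (covec q)), (N <= size s)%N -> ev X s = 0) ->
  vlift X (existT _ p (c *: xi)) =
  (\poly_(r < N) (r`!%:R^-1 * ev X (nseq r xi))).[c].
Proof.
move=> X0; rewrite (vliftE (N := N)) => [|r Nr]; last by rewrite X0 ?size_nseq.
rewrite horner_poly; apply: eq_bigr => r _ /=.
by rewrite -[nseq r (_ *: _)]cats0 ev_nseqZ cats0 mulrCA mulrC.
Qed.

(** The coefficients along the line through [u] give X(u, ..., u) = 0 in each degree, and
    polarization frees the arguments. *)
Lemma vlift_eq0 X : (forall zeta, vlift X zeta = 0) -> X = 0.
Proof.
move=> X0; apply: symfield_ext => p s; rewrite ev0.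
have [N XN] := ev_finite X.
have [sN|/XN//] := ltnP (size s) N; rewrite -[s]cats0.
apply: (@polarization _ _ (size s)) => // u; rewrite cats0.
have P0 : \poly_(r < N) (r`!%:R^-1 * ev X (nseq r u)) = 0.
  by apply: poly_fun_eq0 => t; rewrite -vlift_scale.
have /polyP/(_ (size s)) := P0; rewrite coef_poly sN coef0 => /eqP.
rewrite mulf_eq0 invr_eq0 pnatr_eq0 (gtn_eqF (fact_gt0 _)) /=.
by move=> /eqP.
Qed.

Lemma symz_nseq (V : Type) (T : seq V -> R) m v : symz T (nseq m v) = T (nseq m v).
Proof.
rewrite (symzE T [tuple of nseq m v]) (eq_bigr (fun=> T (nseq m v))) => [|s _].
  rewrite sumr_const card_Sn -[T _ *+ _]mulr_natl mulrA mulVf ?mul1r //.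
congr T; apply: (@eq_from_nth _ v); rewrite size_tuple ?size_nseq // => i im.
rewrite (nth_map (Ordinal im)) ?size_enum_ord // (tnth_nth v) /= !nth_nseq im.
by rewrite ltn_ord.
Qed.

Lemma sprodE X Y p (s : seq (covec p)) : ev (sprod X Y) s =
  \sum_(k < (size s).+1) 'C(size s, k)%:R *
    symz (fun t : seq (covec p) => ev X (take k t) * ev Y (drop k t)) s.
Proof. by []. Qed.

Lemma sprod_nseq X Y p m (u : covec p) : ev (sprod X Y) (nseq m u) =
  \sum_(k < m.+1) 'C(m, k)%:R * (ev X (nseq k u) * ev Y (nseq (m - k) u)).
Proof.
rewrite sprodE size_nseq; apply: eq_bigr => k _; rewrite symz_nseq.
by rewrite take_nseq ?drop_nseq // -ltnS.
Qed.

Lemma sprod_homog r k X Y : homog r X -> homog k Y -> homog (r + k) (sprod X Y).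
Proof.
move=> hX hY p s sn; rewrite sprodE big1 // => j _.
rewrite /symz big1 ?mulr0 // => sigma _.
set t := tval _; have st : size t = size s by rewrite size_tuple.
have js : (j <= size s)%N by rewrite -ltnS.
have [jr|jr] := eqVneq (j : nat) r; last first.
  by rewrite hX ?mul0r // size_takel ?st.
rewrite hY ?mulr0 // size_drop st; apply: contra sn => /eqP <-.
by rewrite -jr subnKC.
Qed.

(** The binomial coefficient in the symmetric product turns the factor 1/r! of the lift into 1/(k!
    (r - k)!), so that the coefficients of degree r form a Cauchy product. *)
Lemma vliftM X Y zeta : vlift (sprod X Y) zeta = vlift X zeta * vlift Y zeta.
Proof.
case: zeta => p xi.
have [N1 X0] := ev_finite X; have [N2 Y0] := ev_finite Y.
have [N3 XY0] := ev_finite (sprod X Y).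
pose pX := \poly_(r < N1) (r`!%:R^-1 * ev X (nseq r xi)).
pose pY := \poly_(r < N2) (r`!%:R^-1 * ev Y (nseq r xi)).
(* Writing [xi] as 1 times [xi] makes the two factors values at 1 of polynomials; N1 + N2 + N3 then
   bounds all the degrees involved. *)
rewrite -[xi]scale1r (vlift_scale _ _ X0) (vlift_scale _ _ Y0) -/pX -/pY scale1r.
have XY0' r : (N1 + N2 + N3 <= r)%N -> ev (sprod X Y) (nseq r xi) = 0.
  by move=> rN; rewrite XY0 // size_nseq (leq_trans _ rN) // leq_addl.
rewrite (vliftE (zeta := existT _ p xi) XY0') -hornerM.
rewrite (@horner_coef_wide _ (N1 + N2 + N3)); last first.
  apply: (leq_trans (size_polyMleq _ _)); rewrite (leq_trans (leq_pred _)) //.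
  apply: leq_trans (leq_addr _ _); apply: leq_add; exact: size_poly.
apply: eq_bigr => r _; rewrite expr1n mulr1 coefM sprod_nseq mulr_sumr.
have pXE k : pX`_k = k`!%:R^-1 * ev X (nseq k xi).
  rewrite coef_poly; case: ltnP => // ?; by rewrite X0 ?size_nseq ?mulr0.
have pYE k : pY`_k = k`!%:R^-1 * ev Y (nseq k xi).
  rewrite coef_poly; case: ltnP => // ?; by rewrite Y0 ?size_nseq ?mulr0.
apply: eq_bigr => k _; rewrite pXE pYE.
have kr : (k <= r)%N by rewrite -ltnS.
have f0 m : m`!%:R != 0 :> R by rewrite pnatr_eq0 -lt0n fact_gt0.
rewrite -(bin_fact kr) !natrM; field.
by rewrite !f0 /= pnatr_eq0 -lt0n bin_gt0 kr.
Qed.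

(** * Smoothness and homogeneity of the vertical lifts *)

Lemma smooth_lsubmx m (U : set 'rV[R]_(n + m)) i : open U ->
  smooth_on U (fun z => lsubmx z 0 i).
Proof.
move=> oU; apply: (smooth_eq oU _ (smooth_coord (lshift m i) oU)) => z _.
by rewrite mxE.
Qed.

Lemma smooth_rsubmx m (U : set 'rV[R]_(m + n)) i : open U ->
  smooth_on U (fun z => rsubmx z 0 i).
Proof.
move=> oU; apply: (smooth_eq oU _ (smooth_coord (rshift m i) oU)) => z _.
by rewrite mxE.
Qed.

Definition nat_dom a : set 'rV[R]_(n + n) := [set z | cimg a (lsubmx z)].

Lemma nat_dom_open a : open (nat_dom a).
Proof.
apply: (@open_comp _ _ (fun z : 'rV[R]_(n + n) => lsubmx z) (cimg a)).
  move=> z _; apply: differentiable_continuous; apply: differentiable_coords => i.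
  exact: (smooth_differentiable (smooth_lsubmx i openT)).
exact: cimg_open.
Qed.

Lemma smooth_base a (f : 'rV[R]_n -> R) : smooth_on (cimg a) f ->
  smooth_on (nat_dom a) (fun z => f (lsubmx z)).
Proof.
move=> sf; apply: (@smooth_comp R (n + n) n (nat_dom a) (cimg a) f
  (fun z => lsubmx z) (@nat_dom_open a)) => // k.
exact: (smooth_lsubmx k (@nat_dom_open a)).
Qed.

(** Induction on the number of slots holding the variable covector: one of them is expanded as sum_k
    p_k dx^k, and dx^k joins the covectors with constant components in [ws]. *)
Lemma ev_nat_smooth X a r (ws : seq 'rV[R]_n) : smooth_on (nat_dom a)
  (fun z => ev X (nseq r (covec_of a (param a (lsubmx z)) (rsubmx z)) ++
                  [seq covec_of a (param a (lsubmx z)) w | w <- ws])).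
Proof.
have oU := @nat_dom_open a.
elim: r ws => [|r IH] ws; first exact: smooth_base (ev_smooth X a ws).
apply: (smooth_eq oU (f := fun z => \sum_k rsubmx z 0 k *
  ev X (nseq r (covec_of a (param a (lsubmx z)) (rsubmx z)) ++
        [seq covec_of a (param a (lsubmx z)) w | w <- delta_mx 0 k :: ws]))).
  move=> z za; have [pa _] := cimgP za.
  rewrite [RHS](@ev_coord _ _ _ _ a) //; apply: eq_bigr => k _.
  by rewrite covec_ofE // /= covec_of_delta ev_catCA.
apply: (smooth_sum _ oU) => k; apply: (smoothM oU); last exact: IH.
exact: (smooth_rsubmx k oU).
Qed.

Lemma vlift_homog_smooth X r : homog r X -> smooth_cot (vlift X).
Proof.
move=> hX a; have oU := @nat_dom_open a.
apply: (smooth_eq oU (f := fun z => r`!%:R^-1 *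
  ev X (nseq r (covec_of a (param a (lsubmx z)) (rsubmx z)) ++ [::]))).
  by move=> z _; rewrite /= (vlift_homog hX) cats0.
apply: (smoothM oU); first exact: smooth_cst.
exact: (ev_nat_smooth X a r [::]).
Qed.

Lemma vlift_smooth X : smooth_cot (vlift X).
Proof.
have [N [Y [hY ->]]] := components X; move=> a; have oU := @nat_dom_open a.
apply: (smooth_eq oU (f := fun z => \sum_(r < N) (vlift (Y r) \o nat_param a) z)).
  by move=> z _; rewrite /= vlift_sum.
by apply: (smooth_sum _ oU) => r; exact: (vlift_homog_smooth (hY r)).
Qed.

Lemma vlift_homogeneous X r : homog r X -> homogeneous_polynomial r (vlift X).
Proof.
move=> hX; split; first exact: vlift_smooth.
move=> c p xi; rewrite !(vlift_homog hX) /= -[nseq r (_ *: _)]cats0 ev_nseqZ cats0.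
by rewrite mulrCA.
Qed.

Lemma vlift_Pol X : Pol (vlift X).
Proof.
have [N [Y [hY ->]]] := components X.
exists N, (fun r => vlift (Y r)); split=> [r|]; first exact: vlift_homogeneous.
by apply/funext => zeta; rewrite vlift_sum fct_sumE.
Qed.

Lemma vlift_inj X Y : (forall zeta, vlift X zeta = vlift Y zeta) -> X = Y.
Proof.
move=> e; apply/eqP; rewrite -subr_eq0; apply/eqP/vlift_eq0 => zeta.
by rewrite vliftD -scaleN1r vliftZ mulN1r e subrr.
Qed.

End Lift.

(** * Finite differences and homogeneous functions *)

Section FiniteDifferences.
Context {R : realType}.

Definition fdiff (V : lmodType R) (s : seq V) (f : V -> R) : V -> R :=
  foldr (fun u (g : V -> R) v => g (v + u) - g v) f s.

Lemma fdiff_cons (V : lmodType R) u s (f : V -> R) v :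
  fdiff (u :: s) f v = fdiff s f (v + u) - fdiff s f v.
Proof. by []. Qed.

Lemma fdiff_catCA (V : lmodType R) u s t (f : V -> R) v :
  fdiff (s ++ u :: t) f v = fdiff (u :: s ++ t) f v.
Proof.
elim: s v => [//|w s IH] v; rewrite cat_cons !fdiff_cons !IH !fdiff_cons.
by rewrite [v + w + u]addrAC; ring.
Qed.

Lemma fdiff_perm (V : lmodType R) s t (f : V -> R) v :
  perm_eq s t -> fdiff s f v = fdiff t f v.
Proof.
elim: s t v => [|u s IH] t v st.
  by move: st => /perm_size /esym /size0nil ->.
have : u \in t by rewrite -(perm_mem st) mem_head.
move=> /path.splitPr ts; case: ts st => t1 t2.
rewrite perm_sym -[u :: t2]cat1s perm_catCA perm_cons perm_sym => st.
by rewrite fdiff_catCA !fdiff_cons !(IH _ _ st).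
Qed.

Definition delta1 (f : R -> R) (t : R) := f (t + 1) - f t.

Lemma iter_delta1_sum m I (r : seq I) (c : I -> R) (F : I -> R -> R) t :
  iter m delta1 (fun t => \sum_(i <- r) c i * F i t) t =
  \sum_(i <- r) c i * iter m delta1 (F i) t.
Proof.
elim: m t => [//|m IH] t; rewrite iterS /delta1 -/delta1 !IH -sumrB.
by apply: eq_bigr => i _; rewrite mulrBr.
Qed.

(** A difference lowers the degree by one: (t + 1)^i - t^i is a combination of the t^j with j < i,
    in which t^(i-1) has coefficient i. The product of these leading coefficients is r!. *)
Lemma iter_delta1_exp r i t : (i <= r)%N ->
  iter r delta1 (fun t => t ^+ i) t = if i == r then r`!%:R else 0.
Proof.
elim: r i t => [|r IH] i t; first by rewrite leqn0 => /eqP ->.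
move=> ir; rewrite iterSr.
have -> : delta1 (fun t => t ^+ i) = fun t => \sum_(j < i) 'C(i, j)%:R * t ^+ j.
  apply/funext => u; rewrite /delta1 [u + 1]addrC exprDn big_ord_recr /=.
  rewrite binn subnn expr0 mul1r addrK; apply: eq_bigr => j _.
  by rewrite expr1n mul1r mulr_natl.
rewrite iter_delta1_sum.
case: eqVneq ir => [-> _|ni ir].
  rewrite big_ord_recr /= IH // eqxx big1 ?add0r => [|j _].
    by rewrite -natrM factS binSn.
  by rewrite IH ?ltn_eqF ?mulr0 // ltnW.
rewrite big1 // => j _; have jr : (j < r)%N.
  by rewrite (leq_trans (ltn_ord j)) // -ltnS ltn_neqAle ni.
by rewrite IH ?ltn_eqF ?mulr0 // ltnW.
Qed.

Lemma fdiff_nseq (V : lmodType R) m u (f : V -> R) t :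
  fdiff (nseq m u) f (t *: u) = iter m delta1 (fun t => f (t *: u)) t.
Proof.
elim: m t => [//|m IH] t; rewrite fdiff_cons iterS /delta1 -/delta1 -!IH.
by rewrite scalerDl scale1r.
Qed.

(** On the line through [u] the function is a multiple of t^r. The factor r! will cancel the 1/r! of
    the vertical lift. *)
Lemma fdiff_homog (V : lmodType R) r u (f : V -> R) :
  (forall t, f (t *: u) = t ^+ r * f u) -> fdiff (nseq r u) f 0 = r`!%:R * f u.
Proof.
move=> fu; rewrite -[0](scale0r u) fdiff_nseq.
have -> : (fun t => f (t *: u)) = fun t => \sum_(i <- [:: f u]) i * t ^+ r.
  by apply/funext => t; rewrite big_seq1 mulrC fu.
rewrite (iter_delta1_sum r _ id (fun=> fun t => t ^+ r)) big_seq1.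
by rewrite iter_delta1_exp // eqxx mulrC.
Qed.

(** * Polynomial functions on R^n and smooth homogeneous functions *)

Section Polynomial.
Variable n : nat.
Implicit Types (f g : 'rV[R]_n -> R).

(* Polynomial functions of degree at most d. *)
Fixpoint polyle (d : nat) f : Prop :=
  if d is d'.+1 then
    exists c (g : 'I_n -> 'rV[R]_n -> R), (forall i, polyle d' (g i)) /\
      forall w, f w = c + \sum_i w 0 i * g i w
  else exists c, forall w, f w = c.

Lemma polyle_ext d f g : (forall w, f w = g w) -> polyle d f -> polyle d g.
Proof. by move=> /funext ->. Qed.

Lemma polyle_cst d (c : R) : polyle d (fun=> c).
Proof.
case: d => [|d]; first by exists c.
elim: d c => [|d IH] c; exists c, (fun _ _ => 0); split=> [i|w].
- by exists 0.
- by rewrite big1 ?addr0 // => i; rewrite mulr0.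
- exact: IH.
- by rewrite big1 ?addr0 // => i; rewrite mulr0.
Qed.

Lemma polyleD d f g : polyle d f -> polyle d g -> polyle d (fun w => f w + g w).
Proof.
elim: d f g => [|d IH] f g.
  by move=> [c fc] [c' gc]; exists (c + c') => w; rewrite fc gc.
move=> [c [f' [Pf fE]]] [c' [g' [Pg gE]]].
exists (c + c'), (fun i w => f' i w + g' i w); split=> [i|w].
  exact: (IH _ _ (Pf i) (Pg i)).
rewrite fE gE addrACA -big_split /=; congr (_ + _); apply: eq_bigr => i _.
by rewrite mulrDr.
Qed.

Lemma polyleZ d c f : polyle d f -> polyle d (fun w => c * f w).
Proof.
elim: d f => [|d IH] f; first by move=> [k fk]; exists (c * k) => w; rewrite fk.
move=> [k [g [Pg fE]]]; exists (c * k), (fun i w => c * g i w).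
split=> [i|w]; first exact: (IH _ (Pg i)).
rewrite fE mulrDr mulr_sumr; congr (_ + _); apply: eq_bigr => i _.
exact: mulrCA.
Qed.

Lemma polyle_sum d I (r : seq I) (F : I -> 'rV[R]_n -> R) :
  (forall i, polyle d (F i)) -> polyle d (fun w => \sum_(i <- r) F i w).
Proof.
move=> PF; elim: r => [|i r IH].
  by apply: polyle_ext (polyle_cst d 0) => w; rewrite big_nil.
by apply: polyle_ext (polyleD (PF i) IH) => w; rewrite big_cons.
Qed.

Lemma polyleS d f : polyle d f -> polyle d.+1 f.
Proof.
elim: d f => [|d IH] f.
  by move=> [c fc]; apply: polyle_ext (polyle_cst 1 c) => w; rewrite fc.
by move=> [c [g [Pg fE]]]; exists c, g; split=> // i; exact: (IH _ (Pg i)).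
Qed.

Lemma polyle_shift d f u : polyle d f -> polyle d (fun w => f (w + u)).
Proof.
elim: d f => [|d IH] f; first by move=> [c fc]; exists c => w; rewrite fc.
move=> [c [g [Pg fE]]].
apply: (@polyle_ext _ (fun w => (c + \sum_i w 0 i * g i (w + u)) +
    \sum_i u 0 i * g i (w + u))).
  move=> w; rewrite fE -addrA -big_split /=; congr (_ + _); apply: eq_bigr => i _.
  by rewrite mxE mulrDl.
apply: polyleD.
  by exists c, (fun i w => g i (w + u)); split=> // i; exact: (IH _ (Pg i)).
by apply: polyleS; apply: polyle_sum => i; apply: polyleZ; exact: (IH _ (Pg i)).
Qed.

(** Discrete Leibniz rule: the difference of w_i g_i(w) is w_i times the difference of g_i, plus u_i
    g_i(w + u), and the induction hypothesis lowers the degree of the former. *)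
Lemma polyle_diff d f u : polyle d.+1 f -> polyle d (fun w => f (w + u) - f w).
Proof.
elim: d f => [|d IH] f [c [g [Pg fE]]].
  exists (\sum_i u 0 i * g i 0) => w; rewrite !fE opprD addrACA subrr add0r -sumrB.
  by apply: eq_bigr => i _; have [k gk] := Pg i; rewrite !gk mxE; ring.
apply: (@polyle_ext _ (fun w => (0 + \sum_i w 0 i * (g i (w + u) - g i w)) +
    \sum_i u 0 i * g i (w + u))).
  move=> w; rewrite !fE opprD addrACA subrr -addrA; congr (_ + _).
  rewrite -big_split -sumrB /=; apply: eq_bigr => i _; rewrite mxE; ring.
apply: polyleD.
  by exists 0, (fun i w => g i (w + u) - g i w); split=> // i; exact: (IH _ (Pg i)).
apply: polyle_sum => i; apply: polyleZ.
exact: (@polyle_shift d.+1 (g i) u (Pg i)).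
Qed.

Lemma polyle_fdiff d s f : polyle (d + size s) f -> polyle d (fdiff s f).
Proof.
elim: s d f => [|u s IH] d f; first by rewrite addn0.
by rewrite /= addnS -addSn => /IH; exact: polyle_diff.
Qed.

(** Such an [f] is affine. Since f u - f 0 is the difference of [f] at 0 in the direction [u], this
    will give the multilinearity of iterated differences. *)
Lemma polyle1_linear f c u v : polyle 1 f ->
  f (c *: u + v) - f 0 = c * (f u - f 0) + (f v - f 0).
Proof.
move=> [k [g [Pg fE]]].
have E w : f w - f 0 = \sum_i w 0 i * g i 0.
  rewrite !fE [X in _ - (_ + X)]big1 ?addr0 => [|i _]; last by rewrite mxE mul0r.
  by rewrite addrC addKr; apply: eq_bigr => i _; have [l gl] := Pg i; rewrite !gl.
rewrite !E mulr_sumr -big_split /=; apply: eq_bigr => i _; rewrite !mxE; ring.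
Qed.

Lemma eq0_continuous (phi : R -> R) : {for 0, continuous phi} ->
  (forall t, t != 0 -> phi t = 0) -> phi 0 = 0.
Proof.
move=> cphi phi0.
have h1 : phi t @[t --> (0 : R)^'] --> phi 0.
  exact: cvg_trans (cvg_app _ (@nbhs_dnbhs _ (0 : R))) cphi.
have h2 : phi t @[t --> (0 : R)^'] --> (0 : R).
  apply: (@cvg_trans _ (cst 0 @ (0 : R)^')); last exact: cvg_cst.
  apply: near_eq_cvg; near=> t; rewrite phi0 //.
  by near: t; exact: nbhs_dnbhs_neq.
exact: (cvg_unique (@Rhausdorff R) h1 h2).
Unshelve. all: by end_near. Qed.

(* The chain rule only gives homogeneity for nonzero factors. *)
Lemma homog_continuous r (g : 'rV[R]_n -> R) w : continuous g ->
  (forall c, c != 0 -> g (c *: w) = c ^+ r * g w) ->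
  forall c, g (c *: w) = c ^+ r * g w.
Proof.
move=> cg gc c; have [->|/gc//] := eqVneq c 0.
apply/eqP; rewrite -subr_eq0; apply/eqP.
apply: (@eq0_continuous (fun t => g (t *: w) - t ^+ r * g w)); last first.
  by move=> t /gc ->; rewrite subrr.
apply: continuousB.
  apply: (@continuous_comp _ _ _ (fun t : R => t *: w) g); last exact: cg.
  exact: scalel_continuous.
apply: continuousM; last exact: cst_continuous.
exact: exprn_continuous.
Qed.

Lemma partial_scale f i c w : (forall w, differentiable f w) ->
  partial i (fun w => f (c *: w)) w = c * partial i f (c *: w).
Proof.
move=> df; rewrite /partial.
have cZ : continuous ( *:%R c : 'rV[R]_n -> 'rV[R]_n) by exact: scaler_continuous.
have dZ : differentiable ( *:%R c : 'rV[R]_n -> 'rV[R]_n) w.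
  exact: linear_differentiable.
have dc : differentiable (f \o *:%R c) w by exact: differentiable_comp.
rewrite [LHS](deriveE _ dc) (diff_comp dZ (df _)) /= (diff_lin _ cZ) linearZ /=.
by rewrite -(deriveE _ (df _)).
Qed.

Lemma euler f r w : (forall w, differentiable f w) ->
  (forall c w, f (c *: w) = c ^+ r * f w) ->
  r%:R * f w = \sum_i w 0 i * partial i f w.
Proof.
move=> df fh.
have <- : 'D_w f w = \sum_i w 0 i * partial i f w.
  rewrite deriveE // [w in 'd f _ w]row_sum_delta linear_sum /=.
  by apply: eq_bigr => i _; rewrite linearZ /= -deriveE.
(* The two derivatives have the same difference quotients, because h w + w = (h + 1) w. *)
have -> : 'D_w f w = 'D_1 (fun t : R => t ^+ r * f w) 1.
  have E : (fun h : R => h^-1 *: ((f \o shift w) (h *: w) - f w)) =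
    (fun h : R => h^-1 *: (((fun t : R => t ^+ r * f w) \o shift 1) (h *: (1 : R)) -
       1 ^+ r * f w)).
    apply/funext => h /=.
    have -> : h *: w + w = (h + 1) *: w by rewrite scalerDl scale1r.
    rewrite fh [h *: (1 : R)]mulr1.
    by rewrite expr1n mul1r.
  by rewrite /derive E.
have h := is_deriveM (is_deriveX r (is_derive_id (1 : R) 1))
  (is_derive_cst (f w) (1 : R) 1).
have -> : (fun t : R => t ^+ r * f w) = id ^+ r * cst (f w).
  by rewrite exprfctE.
have [_ ->] := h.
by rewrite scaler0 add0r expr1n /GRing.scale /= !mulr1 mulrC.
Qed.

(** By Euler's identity [f] is the sum of the w_i times its partial derivatives divided by the
    degree, and these are smooth and homogeneous of one degree less. *)
Lemma homog_polyle r f : smooth_on setT f ->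
  (forall c w, f (c *: w) = c ^+ r * f w) -> polyle r f.
Proof.
elim: r f => [|r IH] f sf fh.
  (* Homogeneity is used with the factor 0, and 0 to the power 0 is 1. *)
  by exists (f 0) => w; rewrite -(scale0r w) fh mul1r.
have df w : differentiable f w by exact: smooth_differentiable sf _.
exists 0, (fun i w => r.+1%:R^-1 * partial i f w); split=> [i|w]; last first.
  rewrite add0r; under eq_bigr do rewrite mulrCA.
  by rewrite -mulr_sumr -(euler _ df fh) mulKf // pnatr_eq0.
apply: polyleZ; apply: IH; first exact: smooth_partial.
move=> c w; apply: homog_continuous => [x|k k0].
  apply: differentiable_continuous.
  exact: smooth_differentiable (smooth_partial i sf) _.
(* Differentiating f(k w) = k^(r+1) f(w) in [w] gives the claim multiplied by [k]. *)
apply: (mulfI k0); rewrite -partial_scale // mulrA -exprS.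
rewrite (_ : (fun w => f (k *: w)) = fun w => k ^+ r.+1 * f w); last first.
  by apply/funext => y; rewrite fh.
have := deriveZ (k ^+ r.+1) (@diff_derivable _ _ _ f w (delta_mx 0 i) (df w)).
exact.
Qed.

End Polynomial.
End FiniteDifferences.
Arguments fdiff : simpl never.

(** * Surjectivity of the vertical lift *)

Section Surjectivity.
Context {R : realType} {n : nat} {M : smoothManifold R n}.
Implicit Types (p q : M) (a b : atlas M) (X Y Z h : symfield M).
Implicit Types (F : cotbundle M -> R).

(** Pullback of [F] along a smooth map written in natural coordinates. It serves for a fixed base
    point with variable momenta, and for a variable base point with constant momenta. *)
Lemma smooth_cot_row F a (l r : 'rV[R]_n -> 'rV[R]_n) (U : set 'rV[R]_n) :
  smooth_cot F -> open U -> (forall x, U x -> cimg a (l x)) ->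
  (forall k, smooth_on U (fun x => l x 0 k)) ->
  (forall k, smooth_on U (fun x => r x 0 k)) ->
  smooth_on U (fun x =>
    F (existT _ (param a (l x)) (covec_of a (param a (l x)) (r x)))).
Proof.
move=> sF oU Ul sl sr.
apply: (smooth_eq oU (f := fun x => (F \o nat_param a) (row_mx (l x) (r x)))).
  by move=> x Ux; rewrite /= /nat_param row_mxKl row_mxKr.
apply: (@smooth_comp R n (n + n) U (nat_dom a) (F \o nat_param a)
  (fun x => row_mx (l x) (r x))) => //.
- by move=> x Ux; rewrite /nat_dom /= row_mxKl; exact: Ul.
- exact: sF.
move=> k; rewrite -(splitK k); case: (fintype.split k) => j /=.
  by apply: (smooth_eq oU _ (sl j)) => x _; rewrite row_mxEl.
by apply: (smooth_eq oU _ (sr j)) => x _; rewrite row_mxEr.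
Qed.

(** Linearity of [covec_of] moves the differences from the cotangent space to R^n, where [polyle]
    makes sense. *)
Lemma fdiff_covec_of a p (f : covec p -> R) (s : seq (covec p)) w : cdom a p ->
  fdiff s f (covec_of a p w) =
  fdiff [seq xi a | xi : covec p <- s] (f \o covec_of a p) w.
Proof.
move=> pa; elim: s w => [//|u s IH] w; rewrite map_cons !fdiff_cons -!IH.
congr (fdiff _ _ _ - _); rewrite -{1}(covec_of_comp u pa).
by rewrite -[w]scale1r covec_ofP !scale1r.
Qed.

Lemma covec_of0 a p : covec_of a p 0 = 0.
Proof. by have := covec_ofP a p (-1) 0 0; rewrite scaler0 addr0 scaleN1r addNr. Qed.

Lemma covec_ofD a p u v : covec_of a p (u + v) = covec_of a p u + covec_of a p v.
Proof. by rewrite -[u]scale1r covec_ofP !scale1r. Qed.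

Lemma covec_ofZ a p c u : covec_of a p (c *: u) = c *: covec_of a p u.
Proof. by rewrite -[c *: u]addr0 covec_ofP covec_of0 addr0. Qed.

Lemma homogeneous_polyle r F a p : cdom a p -> homogeneous_polynomial r F ->
  polyle r (fun w => F (existT _ p (covec_of a p w))).
Proof.
move=> pa [sF hF]; apply: homog_polyle => [|c w]; last first.
  by rewrite covec_ofZ hF.
have oT : open [set: 'rV[R]_n] := openT.
have := @smooth_cot_row F a (fun=> chart a p) id setT sF oT.
rewrite chartK //; apply.
- by move=> x _; exact: cimg_chart.
- by move=> k; exact: smooth_cst.
- by move=> k; exact: smooth_coord.
Qed.

Lemma homogeneous_vlift r F : homogeneous_polynomial r F ->
  exists X, homog r X /\ vlift X = F.
Proof.
move=> hF; have [sF FZ] := hF.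
pose Fp p xi := F (existT (fun p => covec p) p xi).
pose X (z : covecs M) := let: existT p s := z in
  if size s == r then fdiff s (Fp p) 0 else 0.
have [|Y YE] := @symfield_of _ _ _ X; last first.
  have hY : homog r Y by move=> p s /negbTE sr; rewrite YE /= sr.
  exists Y; split=> //; apply/funext => -[p xi]; rewrite (vlift_homog hY) YE /=.
  rewrite size_nseq eqxx (@fdiff_homog _ _ r) => [|t].
    by rewrite mulKf // pnatr_eq0 -lt0n fact_gt0.
  by rewrite /Fp FZ.
split.
- by move=> p s t st /=; rewrite (perm_size st) (fdiff_perm _ _ st).
- move=> p s c u v /=; case: eqP => [sr|_]; last by rewrite mulr0 addr0.
  have [a pa] := atlas_cover p.
  rewrite !fdiff_cons !add0r -(covec_of0 a p).
  rewrite -(covec_of_comp u pa) -(covec_of_comp v pa) -covec_ofP !fdiff_covec_of //.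
  (* On the fibre [F] has degree at most r. The r - 1 differences along [s] leave degree at most 1,
     so the remaining one is linear in its direction. *)
  apply: polyle1_linear; apply: polyle_fdiff; rewrite size_map add1n sr.
  exact: homogeneous_polyle.
- move=> a ws; have oU := @cimg_open _ _ M a.
  case: (eqVneq (size ws) r) => sr; last first.
    apply: (smooth_eq oU _ (smooth_cst 0 oU)) => x _.
    by rewrite /= size_map (negbTE sr).
  (* The differences are taken at an arbitrary covector with constant components, not just at 0, so
     that the induction covers the shifted argument. *)
  have key (us : seq 'rV[R]_n) w : smooth_on (cimg a) (fun x =>
      fdiff [seq covec_of a (param a x) u | u <- us] (Fp (param a x))
        (covec_of a (param a x) w)).
    elim: us w => [|u us IH] w.
      apply: (@smooth_cot_row F a id (fun=> w) _ sF oU) => //.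
        by move=> k; exact: smooth_coord.
      by move=> k; exact: smooth_cst.
    apply: (smooth_eq oU _ (smoothD oU (IH (w + u)) (smoothN oU (IH w)))) => x _.
    by rewrite covec_ofD.
  apply: (smooth_eq oU _ (key ws 0)) => x _.
  by rewrite covec_of0 /= size_map sr eqxx.
- by exists r.+1 => p s rs /=; rewrite gtn_eqF.
Qed.

Lemma vlift_surj F : Pol F -> exists X, vlift X = F.
Proof.
move=> [N [G [hG ->]]].
have /boolp.choice[X XE] : forall r, exists X, vlift X = G r.
  by move=> r; have [X []] := homogeneous_vlift (hG r); exists X.
exists (\sum_(r < N) X r); apply/funext => zeta.
by rewrite vlift_sum fct_sumE; apply: eq_bigr => r _; rewrite XE.
Qed.

(** The degree can be read off the lift: surjectivity holds degree by degree, and injectivity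
    identifies the preimage. *)
Lemma homog_of_vlift r X : homogeneous_polynomial r (vlift X) -> homog r X.
Proof.
move=> /homogeneous_vlift[Y [hY YX]]; suff -> : X = Y by [].
by apply: vlift_inj => zeta; rewrite YX.
Qed.

End Surjectivity.

(** * Derivations at a covector *)

Section Derivations.
Context {R : realType} {n : nat} {M : smoothManifold R n}.
Implicit Types (p q : M) (a b : atlas M) (X Y Z h : symfield M).

Lemma frame_exists a p : cdom a p -> exists (phi : M -> R) (E : 'I_n -> symfield M),
  [/\ is_cutoff a phi, \near p, phi p = 1, forall i, homog 1 (E i) &
    forall i q (xi : covec q), ev (E i) [:: xi] = phi q * xi a 0 i].
Proof.
move=> pa; have [phi [cphi phi1]] := cutoff_exists pa.
have /boolp.choice[E EP] := fun i => coordinate_field i cphi.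
by exists phi, E; split=> // i; have [] := EP i.
Qed.

Lemma smooth_funM (f g : M -> R) : smooth_fun f -> smooth_fun g ->
  smooth_fun (fun q => f q * g q).
Proof. by move=> sf sg a; exact: (smoothM (@cimg_open _ _ _ a) (sf a) (sg a)). Qed.

Lemma cutoff_out a phi q : is_cutoff a phi -> ~ cdom a q -> phi q = 0.
Proof. by move=> [_ [K [_ Ka phi0]]] qa; apply: phi0 => /Ka. Qed.

(** The identity is checked on vertical lifts, where it reads X(xi, ..., xi) = sum_i xi_i X(dx^i,
    xi, ..., xi). The square of phi arises because [E i] and [C i] carry one factor each, and 1/(r +
    1) is the quotient of the factorials in the two lifts. Outside the chart both sides are 0. *)
Lemma euler_decomposition a (phi : M -> R) (E : 'I_n -> symfield M) r X :
  is_cutoff a phi -> (forall i, homog 1 (E i)) ->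
  (forall i q (xi : covec q), ev (E i) [:: xi] = phi q * xi a 0 i) ->
  homog r.+1 X -> exists (F2 : symfield M) (C : 'I_n -> symfield M),
  [/\ homog 0 F2 /\ fn F2 = (fun q => phi q * phi q), forall i, homog r (C i),
    forall i q (s : seq (covec q)), ev (C i) s = phi q * ev X (dcoord a q i :: s) &
    sprod F2 X = \sum_i r.+1%:R^-1 *: sprod (E i) (C i)].
Proof.
move=> cphi hE EE hX; have [sphi _] := cphi.
have [F2 [hF2 F2E]] := function_field (smooth_funM sphi sphi).
have /boolp.choice[C CP] := fun i => contracted_field i X cphi.
have hC i : homog r (C i).
  by move=> p s sr; rewrite CP hX ?mulr0.
exists F2, C; split=> //; apply: vlift_inj => -[q xi].
rewrite vliftM (vlift_fn _ hF2) F2E /= (vlift_homog hX) vlift_sum /=.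
have [qa|qa] := pselect (cdom a q); last first.
  rewrite (cutoff_out cphi qa) mulr0 mul0r big1 // => i _.
  by rewrite vliftZ vliftM (vlift_vf _ (hE i)) EE (cutoff_out cphi qa) !mul0r mulr0.
rewrite (ev_coord _ _ _ qa) !mulr_sumr; apply: eq_bigr => i _.
rewrite vliftZ vliftM (vlift_vf _ (hE i)) EE (vlift_homog (hC i)) CP /=.
rewrite factS natrM; field.
by rewrite !pnatr_eq0 -lt0n fact_gt0 /= addrC natr1 pnatr_eq0.
Qed.

Lemma derivation_eq0 (zeta : cotbundle M) (delta : symfield M -> R) :
  (forall c X Y, delta (c *: X + Y) = c * delta X + delta Y) ->
  (forall X Y, delta (sprod X Y) =
     delta X * vlift Y zeta + vlift X zeta * delta Y) ->
  (forall h, homog 0 h -> delta h = 0) ->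
  (forall X, homog 1 X -> delta X = 0) ->
  forall X, delta X = 0.
Proof.
case: zeta => p xi dP dM d0 d1.
have dsum I (r : seq I) (F : I -> symfield M) :
    (forall i, delta (F i) = 0) -> delta (\sum_(i <- r) F i) = 0.
  move=> F0; elim: r => [|i r IH].
    by rewrite big_nil d0 // => q s _; exact: ev0.
  by rewrite big_cons -[F i]scale1r dP F0 IH mulr0 addr0.
have [a pa] := atlas_cover p.
have [phi [E [cphi phi1 hE EE]]] := frame_exists pa.
have dh r X : homog r X -> delta X = 0.
  elim: r X => [|r IH] X hX; first exact: d0.
  have [F2 [C [[hF2 F2E] hC _ XE]]] := euler_decomposition cphi hE EE hX.
  have : delta (sprod F2 X) = 0.
    rewrite XE; apply: dsum => i; rewrite -[_ *: _]addr0 dP dM d1 // (IH _ (hC i)).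
    by rewrite mul0r mulr0 addr0 mulr0 add0r d0 // => q s _; exact: ev0.
  (* Since phi = 1 at [p] and [delta] kills the function phi^2, [delta] takes the same value on
     phi^2 X as on [X]. *)
  rewrite dM (d0 _ hF2) mul0r add0r (vlift_fn _ hF2) F2E /= (nbhs_singleton phi1).
  by rewrite mulr1 mul1r.
move=> X; have [N [Y [hY ->]]] := components X.
by apply: dsum => r; exact: dh (hY r).
Qed.

End Derivations.

(** * Local expression of the connection *)

Section LocalConnection.
Context {R : realType} {n : nat} {M : smoothManifold R n} (D : connection M).
Implicit Types (p q : M) (a b : atlas M) (X Y Z h : symfield M).

Lemma lie_coord a p X f : cdom a p -> smooth_fun f ->
  lie X f p = \sum_i ev X [:: dcoord a p i] * partial i (f \o param a) (chart a p).
Proof.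
move=> pa sf; rewrite /lie (ev_coord _ _ _ pa); apply: eq_bigr => i _.
by rewrite dcov_smooth // /Defs.dcomp asboolT // mxE mulrC.
Qed.

Lemma near_chart a p (P : M -> Prop) : cdom a p -> (\near p, P p) ->
  \forall x \near chart a p, P (param a x).
Proof.
move=> pa nP; apply: (param_continuous (cimg_chart pa)).
by rewrite /= chartK.
Qed.

Lemma homog0 r : homog r (0 : symfield M).
Proof. by move=> p s _; exact: ev0. Qed.

Lemma homogD r X Y : homog r X -> homog r Y -> homog r (X + Y).
Proof. by move=> hX hY p s sr; rewrite evD hX // hY // addr0. Qed.

Lemma homog_sum r I (s : seq I) (F : I -> symfield M) :
  (forall i, homog r (F i)) -> homog r (\sum_(i <- s) F i).
Proof.
move=> hF; elim: s => [|i s IH]; first by rewrite big_nil; exact: homog0.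
by rewrite big_cons; exact: homogD.
Qed.

Lemma ev_sprod01 h X p (xi : covec p) : homog 0 h -> homog 1 X ->
  ev (sprod h X) [:: xi] = fn h p * ev X [:: xi].
Proof.
move=> hh hX; have := vliftM h X (existT _ p xi).
by rewrite (vlift_vf _ hX) (vlift_fn _ hh) (vlift_vf _ (sprod_homog hh hX)).
Qed.

Lemma nabla_suml I (s : seq I) (F : I -> symfield M) Y :
  (forall i, homog 1 (F i)) -> homog 1 Y ->
  D (\sum_(i <- s) F i) Y = \sum_(i <- s) D (F i) Y.
Proof.
move=> hF hY; elim: s => [|i s IH].
  rewrite !big_nil; apply: (@addrI _ (D 0 Y)).
  by rewrite -nablaDl ?addr0 //; exact: homog0.
by rewrite !big_cons nablaDl // ?IH //; exact: homog_sum.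
Qed.

Lemma nabla_sumr I (s : seq I) (F : I -> symfield M) X :
  (forall i, homog 1 (F i)) -> homog 1 X ->
  D X (\sum_(i <- s) F i) = \sum_(i <- s) D X (F i).
Proof.
move=> hF hX; elim: s => [|i s IH].
  rewrite !big_nil; apply: (@addrI _ (D X 0)).
  by rewrite -nablaDr ?addr0 //; exact: homog0.
by rewrite !big_cons nablaDr // ?IH //; exact: homog_sum.
Qed.

Section Frame.
Variables (a : atlas M) (p : M) (phi : M -> R) (E : 'I_n -> symfield M).
Hypotheses (pa : cdom a p) (cphi : is_cutoff a phi) (phi1 : \near p, phi p = 1).
Hypotheses (hE : forall i, homog 1 (E i)).
Hypotheses (EE : forall i q (xi : covec q), ev (E i) [:: xi] = phi q * xi a 0 i).

Lemma frame_near i : coordinate_field_near a p i (E i).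
Proof.
split; first exact: hE.
by apply: filterS phi1 => q q1 xi; rewrite EE q1 mul1r.
Qed.

Lemma frame_decomposition X : homog 1 X ->
  exists (F2 : symfield M) (x : 'I_n -> symfield M),
  [/\ homog 0 F2 /\ fn F2 = (fun q => phi q * phi q), forall i, homog 0 (x i),
    forall i q, fn (x i) q = phi q * ev X [:: dcoord a q i] &
    sprod F2 X = \sum_i sprod (x i) (E i)].
Proof.
move=> hX; have [F2 [x [hF2 hx xE XE]]] := euler_decomposition cphi hE EE hX.
exists F2, x; split=> //; first by move=> i q; rewrite /fn xE.
rewrite XE; apply: eq_bigr => i _; rewrite invr1 scale1r.
by apply: vlift_inj => zeta; rewrite !vliftM mulrC.
Qed.

(** Tensoriality in [X]: phi^2 X is expanded in the frame, and the function coefficients are pulled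
    out and evaluated at [p], where phi = 1. *)
Lemma nabla_l X Y (xi : covec p) : homog 1 X -> homog 1 Y ->
  ev (D X Y) [:: xi] = \sum_i ev X [:: dcoord a p i] * ev (D (E i) Y) [:: xi].
Proof.
move=> hX hY; have [F2 [x [[hF2 F2E] hx xE XE]]] := frame_decomposition hX.
have : ev (D (sprod F2 X) Y) [:: xi] = ev (D X Y) [:: xi].
  rewrite nablaMl // ev_sprod01 //; last exact: nabla_deg.
  by rewrite F2E (nbhs_singleton phi1) !mul1r.
rewrite XE nabla_suml //; last by move=> i; exact: (sprod_homog (hx i) (hE i)).
rewrite ev_sum => <-; apply: eq_bigr => i _.
rewrite nablaMl // ev_sprod01 //; last exact: nabla_deg.
by rewrite xE (nbhs_singleton phi1) mul1r.
Qed.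

Lemma nabla_r X Y (xi : covec p) : homog 1 X -> homog 1 Y ->
  ev (D X Y) [:: xi] = \sum_j
    ((\sum_i ev X [:: dcoord a p i] *
      partial i (fun x => ev Y [:: dcoord a (param a x) j]) (chart a p)) * xi a 0 j +
     ev Y [:: dcoord a p j] * ev (D X (E j)) [:: xi]).
Proof.
move=> hX hY; have [F2 [y [[hF2 F2E] hy yE YE]]] := frame_decomposition hY.
have : ev (D X (sprod F2 Y)) [:: xi] = ev (D X Y) [:: xi].
  rewrite nabla_leibniz // F2E (nbhs_singleton phi1) !mul1r.
  rewrite (lie_coord _ pa); last by have := fn_smooth F2; rewrite F2E.
  (* Here phi must be 1 near [p], not just at [p]: the derivative of phi^2 in the Leibniz rule then
     vanishes. *)
  rewrite big1 ?mul0r ?add0r // => i _; rewrite (_ : partial _ _ _ = 0) ?mulr0 //.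
  rewrite -[RHS](_ : partial i (cst 1) (chart a p) = 0); last exact: derive_cst.
  apply: near_eq_derive; apply: filterS (near_chart pa phi1) => x /= ->.
  by rewrite mulr1.
rewrite YE nabla_sumr //; last by move=> i; exact: (sprod_homog (hy i) (hE i)).
rewrite ev_sum => <-; apply: eq_bigr => j _.
rewrite nabla_leibniz // yE EE (nbhs_singleton phi1) !mul1r; congr (_ * _ + _).
rewrite (lie_coord _ pa (fn_smooth _)); apply: eq_bigr => i _; congr (_ * _).
apply: near_eq_derive; apply: filterS (near_chart pa phi1) => x /=.
by rewrite yE => ->; rewrite mul1r.
Qed.

(** This makes the description of the Christoffel symbols independent of the chosen extensions: only
    the components of [X] at [p] and the components of [Y] with their first derivatives there
    enter. *)
Lemma nabla_coordinate_fields i j X Y (xi : covec p) :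
  coordinate_field_near a p i X -> coordinate_field_near a p j Y ->
  ev (D X Y) [:: xi] = ev (D (E i) (E j)) [:: xi].
Proof.
move=> [hX nX] [hY nY]; rewrite nabla_l // (bigD1 i) //= big1 ?addr0; last first.
  move=> k ki; rewrite (nbhs_singleton nX) dcoordE // mxE eqxx /= eq_sym.
  by rewrite (negbTE ki) mul0r.
rewrite (nbhs_singleton nX) dcoordE // mxE !eqxx mul1r nabla_r //.
(* The components of [Y] are constant near [p]. *)
have d0 k l : partial l (fun x => ev Y [:: dcoord a (param a x) k]) (chart a p) = 0.
  rewrite -[RHS](_ : partial l (cst (j == k)%:R) (chart a p) = 0); last exact: derive_cst.
  apply: near_eq_derive.
  have na : \near p, cdom a p by apply: open_nbhs_nbhs; split=> //; exact: cdom_open.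
  apply: filterS2 (near_chart pa nY) (near_chart pa na) => x /= Yx xa.
  by rewrite Yx dcoordE // mxE eqxx.
rewrite (bigD1 j) //= [X in _ + X]big1 ?addr0; last first.
  move=> k kj; rewrite (nbhs_singleton nY) dcoordE // mxE eqxx /= eq_sym.
  rewrite (negbTE kj) mul0r addr0 big1 ?mul0r // => l _.
  by rewrite d0 mulr0.
rewrite (nbhs_singleton nY) dcoordE // mxE !eqxx mul1r big1 ?mul0r ?add0r // => l _.
by rewrite d0 mulr0.
Qed.

Lemma christoffelE k i j X Y :
  coordinate_field_near a p i X -> coordinate_field_near a p j Y ->
  christoffel D a p k i j = ev (D X Y) [:: dcoord a p k].
Proof.
move=> cX cY; apply: xget_unique => [|c]; last by move=> /(_ X Y cX cY).
move=> X' Y' cX' cY'; rewrite (nabla_coordinate_fields _ cX cY).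
exact: nabla_coordinate_fields.
Qed.

(** The classical formula X^i d_i Y^k + X^i Y^j Gamma^k_ij, paired with [xi]: [nabla_r] produces the
    derivatives, and [nabla_l] reduces the rest to pairs of frame fields. *)
Lemma nabla_local X Y (xi : covec p) : homog 1 X -> homog 1 Y ->
  ev (D X Y) [:: xi] =
  \sum_j \sum_i ev X [:: dcoord a p i] *
     partial i (fun x => ev Y [:: dcoord a (param a x) j]) (chart a p) * xi a 0 j +
  \sum_i \sum_j ev X [:: dcoord a p i] * ev Y [:: dcoord a p j] *
    \sum_k xi a 0 k * christoffel D a p k i j.
Proof.
move=> hX hY; rewrite nabla_r // big_split /=; congr (_ + _).
  by apply: eq_bigr => j _; rewrite mulr_suml.
rewrite exchange_big /=; apply: eq_bigr => j _.
rewrite nabla_l // mulr_sumr; apply: eq_bigr => i _.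
rewrite mulrCA mulrA; congr (_ * _); rewrite (ev_coord _ _ _ pa).
by apply: eq_bigr => k _; rewrite (christoffelE _ (frame_near i) (frame_near j)).
Qed.

End Frame.

(** One frame serves all points of the open set [W], on which phi = 1: there the symbols are
    components of the global fields [D (E i) (E j)]. *)
Lemma christoffel_smooth a k i j :
  smooth_on (cimg a) (fun x => christoffel D a (param a x) k i j).
Proof.
apply: smooth_local => x xa; have [pa xE] := cimgP xa.
have [phi [E [cphi phi1 hE EE]]] := frame_exists pa.
have [W [oW Wx] W1] :
    exists2 W, open_nbhs (param a x) W & W `<=` [set q | phi q = 1].
  by move: (phi1 : nbhs (param a x) [set q | phi q = 1]); rewrite nbhsE.
exists (cimg a `&` (param a @^-1` W)); split=> //.
have oU := @cimg_param_open _ _ _ a _ oW.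
apply: (smooth_eq oU
  (f := fun y => ev (D (E i) (E j)) [:: dcoord a (param a y) k])).
  move=> y [ya yW]; have [qa _] := cimgP ya.
  have y1 : \forall q \near param a y, phi q = 1.
    exact: (filterS W1 (open_nbhs_nbhs (conj oW yW))).
  by rewrite (christoffelE qa cphi y1 hE EE k (frame_near y1 hE EE i)
    (frame_near y1 hE EE j)).
have := ev_smooth (D (E i) (E j)) a [:: delta_mx 0 k] => /= h.
apply: (smooth_eq oU _ (smooth_subset _ h)) => [y _|y []//].
by rewrite covec_of_delta.
Qed.

End LocalConnection.

(** * The two brackets at a covector *)

Section Brackets.
Context {R : realType} {n : nat} {M : smoothManifold R n} (D : connection M).
Implicit Types (p q : M) (a b : atlas M) (X Y Z h : symfield M).
Implicit Types (F G H : cotbundle M -> R).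

(* The common properties of both brackets at zeta; they determine [beta]. *)
Record point_bracket (zeta : cotbundle M) (beta : symfield M -> symfield M -> R) :
    Prop := PointBracket {
  pb_linear : forall c X Y Z, beta (c *: X + Y) Z = c * beta X Z + beta Y Z;
  pb_comm : forall X Y, beta X Y = beta Y X;
  pb_derivation : forall X Y Z, beta X (sprod Y Z) =
    beta X Y * vlift Z zeta + vlift Y zeta * beta X Z;
  pb_functions : forall h k, homog 0 h -> homog 0 k -> beta h k = 0;
  pb_function : forall X h, homog 1 X -> homog 0 h ->
    beta X h = lie X (fn h) (projT1 zeta);
  pb_vector_fields : forall X Y, homog 1 X -> homog 1 Y ->
    beta X Y = ev (D X Y + D Y X) [:: projT2 zeta] }.

(** The difference [gamma] is a symmetric biderivation at [zeta]. Applying [derivation_eq0] in the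
    second argument kills it for a function, then for a vector field in the first; by symmetry a
    last application covers an arbitrary first argument. *)
Lemma point_bracket_unique zeta beta beta' :
  point_bracket zeta beta -> point_bracket zeta beta' ->
  forall X Y, beta X Y = beta' X Y.
Proof.
move=> pb pb'; pose gamma X Y := beta X Y - beta' X Y.
have gC X Y : gamma X Y = gamma Y X.
  by rewrite /gamma (pb_comm pb) (pb_comm pb').
have vanish X : (forall h, homog 0 h -> gamma X h = 0) ->
    (forall Y, homog 1 Y -> gamma X Y = 0) -> forall Y, gamma X Y = 0.
  move=> g0 g1; apply: (@derivation_eq0 _ _ _ zeta) => // [c Y Z|Y Z].
    by rewrite !(gC X) /gamma (pb_linear pb) (pb_linear pb'); ring.
  by rewrite /gamma (pb_derivation pb) (pb_derivation pb'); ring.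
have g0 h : homog 0 h -> forall Y, gamma h Y = 0.
  move=> hh; apply: vanish => [k hk|Y hY].
    by rewrite /gamma (pb_functions pb) // (pb_functions pb') // subrr.
  by rewrite gC /gamma (pb_function pb) // (pb_function pb') // subrr.
have g1 X : homog 1 X -> forall Y, gamma X Y = 0.
  move=> hX; apply: vanish => [k hk|Y hY]; first by rewrite gC g0.
  by rewrite /gamma (pb_vector_fields pb) // (pb_vector_fields pb') // subrr.
move=> X Y; apply/eqP; rewrite -subr_eq0 -/(gamma X Y) vanish // => Z hZ.
  by rewrite gC g0.
by rewrite gC g1.
Qed.

Lemma schouten_point_bracket B zeta : is_schouten D B ->
  point_bracket zeta (fun X Y => vlift (B X Y) zeta).
Proof.
move=> sB; have BP := schouten_linear sB; have BC := schouten_comm sB.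
have B0 Y : B 0 Y = 0.
  by have := BP (-1) 0 0 Y; rewrite scaler0 addr0 scaleN1r addNr.
have Bsum I (r : seq I) (F : I -> symfield M) Y :
    B (\sum_(i <- r) F i) Y = \sum_(i <- r) B (F i) Y.
  elim: r => [|i r IH]; first by rewrite !big_nil B0.
  by rewrite !big_cons -[F i]scale1r BP IH !scale1r.
split.
- by move=> c X Y Z; rewrite BP vliftP.
- by move=> X Y; rewrite BC.
(* The derivation rule of a Schouten bracket concerns a homogeneous first argument, hence the
   splitting into degrees. *)
- move=> X Y Z; have [N [W [hW ->]]] := components X.
  rewrite !Bsum !vlift_sum mulr_suml mulr_sumr -big_split /=; apply: eq_bigr => r _.
  by rewrite (schouten_derivation sB _ _ (hW r)) vliftD !vliftM.
(* The bracket of two functions would have degree -1: the condition of [schouten_deg] becomes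
   [(size s).+1 != 0], true of every [s]. *)
- move=> h k hh hk; rewrite (_ : B h k = 0) ?vlift0 //.
  by apply: symfield_ext => p s; rewrite (schouten_deg sB hh hk) // ev0.
- move=> X h hX hh; have hB : homog 0 (B X h).
    by move=> p s s0; rewrite (schouten_deg sB hX hh) // addn0 eqSS.
  by rewrite (vlift_fn _ hB) (schouten_function sB).
- move=> X Y hX hY; rewrite (schouten_vector_fields sB) // vlift_vf //.
  by apply: homogD; exact: nabla_deg.
Qed.

Definition dnat a zeta H := grad (H \o nat_param a) (nat_chart a zeta).

(** The bilinear form of the inverse of g_nabla, with A = p_k Gamma^k_ij. Left halves are
    derivatives in the positions and right halves in the momenta; the last two terms together give
    the block A + A^T. *)
Definition pw_form (A : 'M[R]_n) (u v : 'rV[R]_(n + n)) : R :=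
  (rsubmx u *m (lsubmx v)^T) 0 0 + (lsubmx u *m (rsubmx v)^T) 0 0 +
  ((rsubmx u *m A *m (rsubmx v)^T) 0 0 + (rsubmx v *m A *m (rsubmx u)^T) 0 0).

Lemma bracket_inE a F G zeta : pw_bracket_in D a F G zeta =
  pw_form (momentum_christoffel D a zeta) (dnat a zeta F) (dnat a zeta G).
Proof.
rewrite /pw_bracket_in invmx_pw_metric -/(dnat a zeta F) -/(dnat a zeta G) /=.
move: (momentum_christoffel _ _ _) (dnat a zeta F) (dnat a zeta G) => A u v.
rewrite /pw_form.
have -> : (rsubmx v *m A *m (rsubmx u)^T) 0 0 =
    (rsubmx u *m A^T *m (rsubmx v)^T) 0 0.
  rewrite [RHS](_ : _ = (rsubmx u *m A^T *m (rsubmx v)^T)^T 0 0); last first.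
    by rewrite [RHS]mxE.
  by rewrite !trmx_mul !trmxK mulmxA.
rewrite -{1}[u]hsubmxK -{1}[v]hsubmxK.
rewrite mul_row_block !mulmx0 !mulmx1 add0r tr_row_mx mul_row_col mulmxDl.
rewrite mulmxDr mulmxDl addrA [LHS]mxE [X in X + _]mxE -!addrA.
by rewrite [X in _ + (_ + X)]mxE.
Qed.

Lemma pw_bracket_inC a F G zeta :
  pw_bracket_in D a F G zeta = pw_bracket_in D a G F zeta.
Proof.
have trC (u v : 'rV[R]_n) : (u *m v^T) 0 0 = (v *m u^T) 0 0.
  by rewrite -[in RHS](trmxK v) -trmx_mul [RHS]mxE.
rewrite !bracket_inE /pw_form; move: (dnat a zeta F) (dnat a zeta G) => u v.
congr (_ + _); last exact: addrC.
by rewrite (trC (rsubmx u)) (trC (lsubmx u)) addrC.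
Qed.

Lemma nat_chart_dom a zeta : cdom a (projT1 zeta) -> nat_dom a (nat_chart a zeta).
Proof. by move=> pa; rewrite /nat_dom /= row_mxKl; exact: cimg_chart. Qed.

Lemma smooth_cot_differentiable a zeta F : cdom a (projT1 zeta) -> smooth_cot F ->
  differentiable (F \o nat_param a) (nat_chart a zeta).
Proof.
by move=> pa sF; apply: smooth_differentiable (sF a) _; exact: nat_chart_dom.
Qed.

Lemma dnatP a zeta c F G : cdom a (projT1 zeta) -> smooth_cot F -> smooth_cot G ->
  dnat a zeta (c *: F + G) = c *: dnat a zeta F + dnat a zeta G.
Proof.
move=> pa /(smooth_cot_differentiable pa) dF /(smooth_cot_differentiable pa) dG.
apply/rowP => i; rewrite !mxE /partial.
rewrite -[(c *: F + G) \o _]/(c *: (F \o nat_param a) + (G \o nat_param a)).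
rewrite deriveD ?deriveZ //; try exact: diff_derivable.
by apply: derivableZ; exact: diff_derivable.
Qed.

Lemma dnatM a zeta F G : cdom a (projT1 zeta) -> smooth_cot F -> smooth_cot G ->
  dnat a zeta (fun z => F z * G z) =
  F zeta *: dnat a zeta G + G zeta *: dnat a zeta F.
Proof.
move=> pa /(smooth_cot_differentiable pa) dF /(smooth_cot_differentiable pa) dG.
apply/rowP => i; rewrite !mxE /partial.
rewrite -[_ \o _]/((F \o nat_param a) * (G \o nat_param a)).
by rewrite deriveM; [rewrite /= nat_chartK|exact: diff_derivable|exact: diff_derivable].
Qed.

Lemma partial_lsub (f : 'rV[R]_n -> R) z j : differentiable f (lsubmx z) ->
  partial j (fun z : 'rV[R]_(n + n) => f (lsubmx z)) z =
  \sum_k partial k f (lsubmx z) * (lshift n k == j)%:R.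
Proof.
move=> df; rewrite (@partial_comp _ _ _ f (fun z : 'rV[R]_(n + n) => lsubmx z)) //.
  apply: eq_bigr => k _; congr (_ * _).
  rewrite (_ : (fun y => lsubmx y 0 k) = fun y => y 0 (lshift n k)).
    exact: partial_coord.
  by apply/funext => y; rewrite mxE.
move=> k; exact: (smooth_differentiable (smooth_lsubmx k openT)).
Qed.

Lemma partial_lsub_l (f : 'rV[R]_n -> R) z i : differentiable f (lsubmx z) ->
  partial (lshift n i) (fun z : 'rV[R]_(n + n) => f (lsubmx z)) z =
  partial i f (lsubmx z).
Proof.
move=> /partial_lsub ->; rewrite (bigD1 i) //= eqxx mulr1 big1 ?addr0 // => k ki.
by rewrite eq_lshift (negbTE ki) mulr0.
Qed.

Lemma partial_lsub_r (f : 'rV[R]_n -> R) z i : differentiable f (lsubmx z) ->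
  partial (rshift n i) (fun z : 'rV[R]_(n + n) => f (lsubmx z)) z = 0.
Proof.
by move=> /partial_lsub ->; rewrite big1 // => k _; rewrite eq_lrshift mulr0.
Qed.

Lemma dnat_fn a zeta h : cdom a (projT1 zeta) -> homog 0 h ->
  dnat a zeta (vlift h) =
  row_mx (grad (fn h \o param a) (chart a (projT1 zeta))) 0.
Proof.
move=> pa hh; have -> : vlift h = fun zeta => fn h (projT1 zeta).
  by apply/funext => z; rewrite vlift_fn.
have df : differentiable (fn h \o param a) (lsubmx (nat_chart a zeta)).
  rewrite row_mxKl; exact: (smooth_differentiable (fn_smooth h a) (cimg_chart pa)).
apply/rowP => j; rewrite [LHS]mxE -(splitK j); case: (fintype.split j) => i /=.
  rewrite row_mxEl mxE -[in RHS](row_mxKl (chart a (projT1 zeta)) (projT2 zeta a)).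
  exact: (partial_lsub_l i df).
by rewrite row_mxEr mxE; exact: (partial_lsub_r i df).
Qed.

(** In natural coordinates the lift is sum_k p_k X^k(x), to which the product rule applies. *)
Lemma dnat_vf a zeta X : cdom a (projT1 zeta) -> homog 1 X ->
  dnat a zeta (vlift X) =
  row_mx (\row_i \sum_k projT2 zeta a 0 k *
      partial i (fun x => ev X [:: dcoord a (param a x) k]) (chart a (projT1 zeta)))
    (\row_k ev X [:: dcoord a (projT1 zeta) k]).
Proof.
move=> pa hX; pose f k (x : 'rV[R]_n) := ev X [:: dcoord a (param a x) k].
have sf k : smooth_on (cimg a) (f k).
  apply: (smooth_eq (@cimg_open _ _ _ a) _ (ev_smooth X a [:: delta_mx 0 k])).
  by move=> x _ /=; rewrite covec_of_delta.
set z0 := nat_chart a zeta.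
have z0l : lsubmx z0 = chart a (projT1 zeta) by rewrite row_mxKl.
have z0r : rsubmx z0 = projT2 zeta a by rewrite row_mxKr.
have df k : differentiable (f k) (lsubmx z0).
  by rewrite z0l; exact: (smooth_differentiable (sf k) (cimg_chart pa)).
have dfl k : differentiable (fun z : 'rV[R]_(n + n) => f k (lsubmx z)) z0.
  apply: (smooth_differentiable (smooth_base (sf k))); exact: nat_chart_dom.
have dr k : differentiable (fun z : 'rV[R]_(n + n) => rsubmx z 0 k) z0.
  exact: (smooth_differentiable (smooth_rsubmx k openT)).
have partial_r k j : partial j (fun z : 'rV[R]_(n + n) => rsubmx z 0 k) z0 =
    (rshift n k == j)%:R.
  rewrite (_ : (fun y => rsubmx y 0 k) = fun y => y 0 (rshift n k)).
    exact: partial_coord.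
  by apply/funext => y; rewrite mxE.
have pE j : partial j (vlift X \o nat_param a) z0 =
    \sum_k (rsubmx z0 0 k * partial j (fun z => f k (lsubmx z)) z0 +
            f k (lsubmx z0) * (rshift n k == j)%:R).
  transitivity (partial j (\sum_k (fun z : 'rV[R]_(n + n) => rsubmx z 0 k) *
      (fun z : 'rV[R]_(n + n) => f k (lsubmx z))) z0).
    apply: near_eq_derive; apply: (open_near (@nat_dom_open _ _ M a)).
      exact: nat_chart_dom.
    move=> z za; have [qa _] := cimgP za.
    rewrite fct_sumE /= (vlift_vf _ hX) /= (ev_coord _ _ _ qa).
    by apply: eq_bigr => k _; rewrite covec_ofE.
  rewrite /partial derive_sum => [|k]; last first.
    by apply: derivableM; exact: diff_derivable.
  apply: eq_bigr => k _.
  rewrite deriveM; [|exact: diff_derivable|exact: diff_derivable].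
  by rewrite -/(partial _ _ _) -/(partial _ _ _) partial_r.
apply/rowP => j; rewrite [LHS]mxE pE -(splitK j); case: (fintype.split j) => i /=.
  rewrite row_mxEl mxE; apply: eq_bigr => k _.
  by rewrite partial_lsub_l // eq_rlshift mulr0 addr0 z0r z0l.
rewrite row_mxEr mxE (bigD1 i) //= big1 ?addr0 => [|k ki].
  by rewrite partial_lsub_r // eqxx mulr0 add0r mulr1 z0l /f chartK.
by rewrite partial_lsub_r // eq_rshift (negbTE ki) !mulr0 addr0.
Qed.

Lemma pw_point_bracket a zeta : cdom a (projT1 zeta) ->
  point_bracket zeta (fun X Y => pw_bracket_in D a (vlift X) (vlift Y) zeta).
Proof.
move=> pa; have C := @pw_bracket_inC a.
have bE F G : pw_bracket_in D a F G zeta =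
   (dnat a zeta F *m invmx (pw_metric D a zeta) *m (dnat a zeta G)^T) 0 0 by [].
split.
- move=> c X Y Z; rewrite vlift_linear !bE dnatP //; try exact: vlift_smooth.
  by rewrite !mulmxDl -!scalemxAl 2!mxE.
- by move=> X Y; exact: C.
- move=> X Y Z; rewrite !(C (vlift X)) !bE.
  have -> : vlift (sprod Y Z) = fun z => vlift Y z * vlift Z z.
    by apply/funext => z; exact: vliftM.
  rewrite dnatM //; try exact: vlift_smooth.
  have aE (P Q : 'M[R]_1) : (P + Q) 0 0 = P 0 0 + Q 0 0 by rewrite mxE.
  have zE c (P : 'M[R]_1) : (c *: P) 0 0 = c * P 0 0 by rewrite mxE.
  by rewrite !mulmxDl -!scalemxAl aE !zE addrC; congr (_ + _); exact: mulrC.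
- move=> h k hh hk; rewrite bracket_inE /pw_form !dnat_fn // !row_mxKr !row_mxKl.
  by rewrite trmx0 !mul0mx !mulmx0 !mxE !addr0.
- move=> X h hX hh.
  rewrite bracket_inE /pw_form dnat_vf // dnat_fn // !row_mxKr !row_mxKl.
  have m0 : (0 : 'M[R]_1) 0 0 = 0 by rewrite mxE.
  rewrite trmx0 !mul0mx !mulmx0 m0 !addr0.
  rewrite (lie_coord _ pa (fn_smooth h)) mxE; apply: eq_bigr => k _.
  by rewrite !mxE.
- move=> X Y hX hY; rewrite bracket_inE /pw_form !dnat_vf // !row_mxKr !row_mxKl.
  have [phi [E [cphi phi1 hE EE]]] := frame_exists pa.
  rewrite evD !(nabla_local D pa cphi phi1 hE EE) //.
  set xi := projT2 zeta; set p := projT1 zeta.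
  set x := chart a p.
  (* A momentum derivative paired with a position derivative is the derivative part of
     [nabla_local]. *)
  have dE (U V : symfield M) : ((\row_k ev U [:: dcoord a p k]) *m
      (\row_i \sum_k xi a 0 k *
        partial i (fun x => ev V [:: dcoord a (param a x) k]) x)^T) 0 0 =
      \sum_j \sum_i ev U [:: dcoord a p i] *
        partial i (fun x => ev V [:: dcoord a (param a x) j]) x * xi a 0 j.
    rewrite exchange_big mxE; apply: eq_bigr => i _; rewrite !mxE mulr_sumr.
    by apply: eq_bigr => j _; rewrite mulrCA mulrC.
  (* The terms in the matrix p_k Gamma^k_ij are the Christoffel parts of the two covariant
     derivatives. *)
  have AE (U V : symfield M) : ((\row_k ev U [:: dcoord a p k]) *m
      momentum_christoffel D a zeta *m (\row_k ev V [:: dcoord a p k])^T) 0 0 =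
      \sum_i \sum_j ev U [:: dcoord a p i] * ev V [:: dcoord a p j] *
        \sum_k xi a 0 k * christoffel D a p k i j.
    rewrite exchange_big mxE; apply: eq_bigr => j _; rewrite !mxE mulr_suml.
    by apply: eq_bigr => i _; rewrite !mxE mulrAC.
  rewrite !AE dE.
  have -> : forall u v : 'rV[R]_n, (u *m v^T) 0 0 = (v *m u^T) 0 0.
    by move=> u v; rewrite -[in RHS](trmxK v) -trmx_mul [RHS]mxE.
  by rewrite dE addrACA.
Qed.

End Brackets.

(** * Existence of the Schouten bracket *)

Section Existence.
Context {R : realType} {n : nat} {M : smoothManifold R n} (D : connection M).
Implicit Types (p q : M) (a b : atlas M) (X Y Z h : symfield M).

(** The expressions in any two natural charts are both point brackets at [zeta], so
    [point_bracket_unique] makes them agree; no change of coordinates is computed. *)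
Lemma pw_bracketE a zeta X Y : cdom a (projT1 zeta) ->
  pw_bracket D (vlift X) (vlift Y) zeta = pw_bracket_in D a (vlift X) (vlift Y) zeta.
Proof.
move=> pa; apply: xget_unique => [b pb|c /(_ _ pa) //].
exact: (point_bracket_unique (pw_point_bracket D pb) (pw_point_bracket D pa)).
Qed.

Lemma pw_bracket_point_bracket zeta :
  point_bracket D zeta (fun X Y => pw_bracket D (vlift X) (vlift Y) zeta).
Proof.
have [a pa] := atlas_cover (projT1 zeta).
rewrite (_ : (fun _ => _) = fun X Y => pw_bracket_in D a (vlift X) (vlift Y) zeta).
  exact: pw_point_bracket.
by apply/funext => X; apply/funext => Y; exact: pw_bracketE.
Qed.

(** * Smoothness and homogeneity of the bracket of g_nabla *)

Lemma pw_bracket_smooth X Y : smooth_cot (pw_bracket D (vlift X) (vlift Y)).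
Proof.
move=> a; have oU := @nat_dom_open _ _ M a.
pose G Z : 'rV[R]_(n + n) -> R := vlift Z \o nat_param a.
(* [u] and [v] are the derivatives in the momenta and in the positions; with the matrix [A] they
   make the bracket an explicit finite sum of products. *)
pose u Z (i : 'I_n) z := partial (rshift n i) (G Z) z.
pose v Z (i : 'I_n) z := partial (lshift n i) (G Z) z.
pose A (i j : 'I_n) (z : 'rV[R]_(n + n)) :=
  \sum_k rsubmx z 0 k * christoffel D a (param a (lsubmx z)) k i j.
apply: (smooth_eq oU (f := fun z =>
  (\sum_i u X i z * v Y i z + \sum_i v X i z * u Y i z) +
  (\sum_j (\sum_i u X i z * A i j z) * u Y j z +
   \sum_j (\sum_i u Y i z * A i j z) * u X j z))).
  move=> z za; have [pa _] := cimgP za.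
  rewrite /= (@pw_bracketE a (nat_param a z) _ _ pa).
  rewrite bracket_inE /pw_form /dnat nat_paramK // ![in RHS]mxE.
  congr (_ + _ + (_ + _)); apply: eq_bigr => i _; rewrite !mxE //.
    congr (_ * _); apply: eq_bigr => j _; rewrite !mxE; congr (_ * _).
    by apply: eq_bigr => k _; rewrite /= covec_ofE.
  congr (_ * _); apply: eq_bigr => j _; rewrite !mxE; congr (_ * _).
  by apply: eq_bigr => k _; rewrite /= covec_ofE.
have su Z i : smooth_on (nat_dom a) (u Z i).
  exact: smooth_partial (vlift_smooth Z a).
have sv Z i : smooth_on (nat_dom a) (v Z i).
  exact: smooth_partial (vlift_smooth Z a).
have sA i j : smooth_on (nat_dom a) (A i j).
  apply: (smooth_sum _ oU) => k; apply: (smoothM oU); first exact: smooth_rsubmx.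
  exact: smooth_base (christoffel_smooth D a k i j).
have suv Z Z' : smooth_on (nat_dom a) (fun z => \sum_i u Z i z * v Z' i z).
  by apply: (smooth_sum _ oU) => i; exact: (smoothM oU (su Z i) (sv Z' i)).
have svu Z Z' : smooth_on (nat_dom a) (fun z => \sum_i v Z i z * u Z' i z).
  by apply: (smooth_sum _ oU) => i; exact: (smoothM oU (sv Z i) (su Z' i)).
have suA Z j : smooth_on (nat_dom a) (fun z => \sum_i u Z i z * A i j z).
  by apply: (smooth_sum _ oU) => i; exact: (smoothM oU (su Z i) (sA i j)).
have suAu Z Z' : smooth_on (nat_dom a)
    (fun z => \sum_j (\sum_i u Z i z * A i j z) * u Z' j z).
  by apply: (smooth_sum _ oU) => j; exact: (smoothM oU (suA Z j) (su Z' j)).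
exact: (smoothD oU (smoothD oU (suv X Y) (svu X Y))
  (smoothD oU (suAu X Y) (suAu Y X))).
Qed.

(** Chain rule for G o S = k G with S(x, p) = (x, c p). The momentum part keeps the factor [c] on
    the left, so that no division occurs. *)
Lemma grad_fibre_scale (G : 'rV[R]_(n + n) -> R) c k z0 :
  let S z := row_mx (lsubmx z) (c *: rsubmx z) in
  differentiable G z0 -> differentiable G (S z0) ->
  (forall z, G (S z) = k * G z) ->
  lsubmx (grad G (S z0)) = k *: lsubmx (grad G z0) /\
  c *: rsubmx (grad G (S z0)) = k *: rsubmx (grad G z0).
Proof.
move=> S dG dGS GS.
have SlE (i : 'I_n) : (fun z => S z 0 (lshift n i)) = (fun z => z 0 (lshift n i)).
  by apply/funext => z; rewrite row_mxEl mxE.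
have SrE (i : 'I_n) : (fun z => S z 0 (rshift n i)) =
    c *: (fun z : 'rV[R]_(n + n) => z 0 (rshift n i)).
  by apply/funext => z; rewrite row_mxEr !mxE.
have dcoord0 j : differentiable (fun z : 'rV[R]_(n + n) => z 0 j) z0.
  by have [] := diff_coord j z0 0.
have dS l : differentiable (fun z => S z 0 l) z0.
  rewrite -(splitK l); case: (fintype.split l) => i /=; first by rewrite SlE.
  by rewrite SrE; exact: differentiableZ.
have key j : \sum_l partial l G (S z0) * partial j (fun z => S z 0 l) z0 =
    k * partial j G z0.
  rewrite -(partial_comp j dS dGS) (_ : (fun z => G (S z)) = k *: G).
    by rewrite /partial deriveZ //; exact: diff_derivable.
  by apply/funext => z; rewrite GS.
have pl j (i : 'I_n) :
    partial j (fun z => S z 0 (lshift n i)) z0 = (lshift n i == j)%:R.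
  by rewrite SlE partial_coord.
have pr j (i : 'I_n) :
    partial j (fun z => S z 0 (rshift n i)) z0 = c * (rshift n i == j)%:R.
  rewrite SrE -(partial_coord j (rshift n i) z0) /partial deriveZ //.
  exact: diff_derivable.
split; apply/rowP => i; rewrite !mxE -key big_split_ord /=.
  rewrite (bigD1 i) //= pl eqxx mulr1 !big1 ?addr0 // => l li; rewrite ?pl ?pr.
    by rewrite eq_rlshift !mulr0.
  by rewrite eq_lshift (negbTE li) mulr0.
rewrite [X in _ + X](bigD1 i) //= pr eqxx mulr1 mulrC.
rewrite !big1 ?addr0 ?add0r // => l li; rewrite ?pl ?pr.
  by rewrite eq_rshift (negbTE li) !mulr0.
by rewrite eq_lrshift !mulr0.
Qed.

Lemma dnat_scale a p (xi : covec p) r c X : cdom a p -> homog r X ->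
  lsubmx (dnat a (existT _ p (c *: xi)) (vlift X)) =
    c ^+ r *: lsubmx (dnat a (existT _ p xi) (vlift X)) /\
  c *: rsubmx (dnat a (existT _ p (c *: xi)) (vlift X)) =
    c ^+ r *: rsubmx (dnat a (existT _ p xi) (vlift X)).
Proof.
move=> pa hX; set z0 := nat_chart a (existT _ p xi).
have Sz0 : nat_chart a (existT _ p (c *: xi)) = row_mx (lsubmx z0) (c *: rsubmx z0).
  by rewrite row_mxKl row_mxKr.
have dG zeta : cdom a (projT1 zeta) ->
    differentiable (vlift X \o nat_param a) (nat_chart a zeta).
  by move=> qa; apply: smooth_cot_differentiable => //; exact: vlift_smooth.
have dG0 : differentiable (vlift X \o nat_param a) z0 by exact: dG.
have dGS := dG (existT _ p (c *: xi)) pa; rewrite Sz0 in dGS.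
have GS z : (vlift X \o nat_param a) (row_mx (lsubmx z) (c *: rsubmx z)) =
    c ^+ r * (vlift X \o nat_param a) z.
  rewrite /nat_param /= row_mxKl row_mxKr covec_ofZ.
  by have [_ ->] := vlift_homogeneous hX.
by have := grad_fibre_scale dG0 dGS GS; rewrite /dnat Sz0.
Qed.

(** A position derivative keeps the degree and a momentum derivative lowers it by one. Mixed terms
    contain one momentum derivative, the others two and a factor linear in the momenta, so every
    term has degree r + k - 1. *)
Lemma pw_form_scale (A : 'M[R]_n) (u v u' v' : 'rV[R]_(n + n)) t r k : t != 0 ->
  lsubmx u' = t ^+ r *: lsubmx u -> t *: rsubmx u' = t ^+ r *: rsubmx u ->
  lsubmx v' = t ^+ k *: lsubmx v -> t *: rsubmx v' = t ^+ k *: rsubmx v ->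
  t * pw_form (t *: A) u' v' = t ^+ r * t ^+ k * pw_form A u v.
Proof.
move=> t0 ul ur vl vr; rewrite /pw_form.
have solve (w w' : 'rV[R]_n) s : t *: w' = s *: w -> w' = (t^-1 * s) *: w.
  by move=> e; rewrite -scalerA -e scalerA mulVf // scale1r.
rewrite ul vl (solve _ _ _ ur) (solve _ _ _ vr).
have trZ s (w : 'rV[R]_n) : (s *: w)^T = s *: w^T by rewrite linearZ.
rewrite !trZ -!(scalemxAl, scalemxAr).
have zE s (P : 'M[R]_1) : (s *: P) 0 0 = s * P 0 0 by rewrite mxE.
by rewrite !zE; field.
Qed.

Lemma momentum_christoffel_scale a p (xi : covec p) t :
  momentum_christoffel D a (existT _ p (t *: xi)) =
  t *: momentum_christoffel D a (existT _ p xi).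
Proof.
apply/matrixP => i j; rewrite !mxE mulr_sumr; apply: eq_bigr => l _.
by rewrite /= mxE mulrA.
Qed.

Lemma pw_bracket_homogeneous r k m X Y :
  homog r X -> homog k Y -> (r + k = m.+1)%N ->
  homogeneous_polynomial m (pw_bracket D (vlift X) (vlift Y)).
Proof.
move=> hX hY rk; split; first exact: pw_bracket_smooth.
move=> c p xi; have [a pa] := atlas_cover p.
(* The scaling of momentum derivatives can only be solved for nonzero [t]. *)
have scale (eta : covec p) t : t != 0 ->
    pw_bracket D (vlift X) (vlift Y) (existT _ p (t *: eta)) =
    t ^+ m * pw_bracket D (vlift X) (vlift Y) (existT _ p eta).
  move=> t0; apply: (mulfI t0).
  have tE : t ^+ r * t ^+ k = t * t ^+ m by rewrite -exprD rk exprS.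
  rewrite [RHS]mulrA -tE.
  rewrite (@pw_bracketE a (existT _ p (t *: eta)) _ _ pa).
  rewrite (@pw_bracketE a (existT _ p eta) _ _ pa) !bracket_inE.
  have [Xl Xr] := dnat_scale eta t pa hX; have [Yl Yr] := dnat_scale eta t pa hY.
  by rewrite momentum_christoffel_scale; exact: pw_form_scale.
(* The factor 0 is reached by continuity along the fibre. *)
have := @homog_continuous R n m
  (fun w => pw_bracket D (vlift X) (vlift Y) (existT _ p (covec_of a p w))) (xi a).
rewrite covec_of_comp // => h; rewrite -[in LHS](covec_of_comp xi pa) -covec_ofZ.
apply: h => [|t t0]; last by rewrite covec_ofZ covec_of_comp // scale.
have oT : open [set: 'rV[R]_n] := openT.
move=> w; apply: differentiable_continuous.
apply: (smooth_differentiable (U := setT)) => //.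
have := @smooth_cot_row _ _ _ _ a (fun=> chart a p) id setT
  (pw_bracket_smooth X Y) oT.
rewrite chartK //; apply.
- by move=> x _; exact: cimg_chart.
- by move=> l; exact: smooth_cst.
- by move=> l; exact: smooth_coord.
Qed.

Lemma point_bracket_sum zeta beta I J (r : seq I) (s : seq J) F G :
  point_bracket D zeta beta ->
  beta (\sum_(i <- r) F i) (\sum_(j <- s) G j) =
  \sum_(i <- r) \sum_(j <- s) beta (F i) (G j).
Proof.
move=> pb; have b0 Y : beta 0 Y = 0.
  by have := pb_linear pb (-1) 0 0 Y; rewrite scaler0 addr0 mulN1r addNr.
have bl K (t : seq K) (H : K -> symfield M) Y :
    beta (\sum_(i <- t) H i) Y = \sum_(i <- t) beta (H i) Y.
  elim: t => [|i t IH]; first by rewrite !big_nil b0.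
  by rewrite !big_cons -[H i]scale1r (pb_linear pb) IH scale1r mul1r.
rewrite bl; apply: eq_bigr => i _; rewrite (pb_comm pb) bl.
by apply: eq_bigr => j _; rewrite (pb_comm pb).
Qed.

Lemma pw_bracket_lift X Y : exists Z, vlift Z = pw_bracket D (vlift X) (vlift Y).
Proof.
have [N [U [hU ->]]] := components X; have [N' [V [hV ->]]] := components Y.
have /boolp.choice[Z ZE] : forall rk : nat * nat, exists Z,
    vlift Z = pw_bracket D (vlift (U rk.1)) (vlift (V rk.2)).
  (* For r + k = 0 both fields are functions and the bracket is 0; otherwise it has degree r + k -
     1, here [m]. *)
  move=> [r k] /=; case e : (r + k)%N => [|m].
    exists 0; apply/funext => zeta; rewrite vlift0.
    have /eqP := e; rewrite addn_eq0 => /andP[/eqP r0 /eqP k0].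
    apply/esym; apply: (pb_functions (pw_bracket_point_bracket zeta)).
      by rewrite r0; exact: hU.
    by rewrite k0; exact: hV.
  have [Z [_ ZE]] := homogeneous_vlift (pw_bracket_homogeneous (hU r) (hV k) e).
  by exists Z.
exists (\sum_(r < N) \sum_(k < N') Z ((r : nat), (k : nat))).
apply/funext => zeta; rewrite vlift_sum.
rewrite (point_bracket_sum _ _ _ _ (pw_bracket_point_bracket zeta)).
by apply: eq_bigr => r _; rewrite vlift_sum; apply: eq_bigr => k _; rewrite ZE.
Qed.

Lemma schouten_exists : exists B, is_schouten D B.
Proof.
have /boolp.choice[B' BE'] : forall XY : symfield M * symfield M, exists Z,
    vlift Z = pw_bracket D (vlift XY.1) (vlift XY.2).
  by move=> [X Y]; exact: pw_bracket_lift.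
pose B X Y := B' (X, Y).
have BE X Y zeta : vlift (B X Y) zeta = pw_bracket D (vlift X) (vlift Y) zeta.
  by rewrite /B BE'.
have pb := pw_bracket_point_bracket.
have deg r k m X Y : homog r X -> homog k Y -> (r + k = m.+1)%N -> homog m (B X Y).
  move=> hX hY e; apply: (@homog_of_vlift _ _ _ m (B X Y)).
  rewrite (_ : vlift (B X Y) = pw_bracket D (vlift X) (vlift Y)).
    exact: (pw_bracket_homogeneous hX hY e).
  exact/funext/BE.
exists B; split.
- move=> c X Y Z; apply: vlift_inj => zeta.
  by rewrite vliftP !BE (pb_linear (pb zeta)).
- by move=> X Y; apply: vlift_inj => zeta; rewrite !BE (pb_comm (pb zeta)).
- move=> X Y hX hY; apply: vlift_inj => zeta.
  rewrite BE (pb_vector_fields (pb zeta)) // vlift_vf //.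
  by apply: homogD; exact: nabla_deg.
- move=> X h hX hh p; have hB : homog 0 (B X h) by exact: (deg 1%N 0%N).
  (* A function is read off its lift at any covector over [p]; the zero covector is chosen. *)
  have := BE X h (existT _ p (0 : covec p)).
  by rewrite (vlift_fn _ hB) (pb_function (pb _)).
- move=> r k X Y hX hY p s; case e : (r + k)%N => [|m] sm.
    have /eqP := e; rewrite addn_eq0 => /andP[/eqP r0 /eqP k0].
    rewrite r0 in hX; rewrite k0 in hY.
    suff -> : B X Y = 0 by exact: ev0.
    by apply: vlift_inj => zeta; rewrite BE vlift0 (pb_functions (pb zeta)).
  exact: (deg _ _ _ _ _ hX hY e).
- move=> r X Y Z _; apply: vlift_inj => zeta.
  by rewrite vliftD !vliftM !BE (pb_derivation (pb zeta)).
Qed.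

End Existence.

Theorem proposition6p5 (R : realType) (n : nat) (M : smoothManifold R n)
    (D : connection M) (D_torsion_free : torsion_free D) :
  algebra_isomorphism (schouten D) (@Pol R n M) (pw_bracket D) (@vlift R n M).
Proof.
(* Existence is what gives the definite description [schouten] its defining properties. *)
have sD : is_schouten D (schouten D) := xgetPex _ (schouten_exists D).
split.
- exact: vlift_linear.
- split.
  + by move=> X _; exact: vlift_Pol.
  + by move=> X Y _ _ e; apply: vlift_inj => zeta; rewrite e.
  + by move=> F /vlift_surj[X XE]; exists X.
- move=> X Y; apply/funext => zeta.
  exact: (point_bracket_unique (schouten_point_bracket zeta sD)
    (pw_bracket_point_bracket D zeta)).
Qed.
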